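(* Let $u$ be the unique bounded viscosity solution of the Hamilton--Jacobi--Bellman problem (HJB) stated in the context. For every $h\in(0,\min\{h_0,\lambda^{-1}\})$, let $u_h\in\mathcal X_h$ be the unique solution of the discrete scheme (S) stated in the context. Then $$I_h[u_h]\to u\qquad\text{locally uniformly on }\Gamma\text{ as }h\to0,$$ where $I_h[\cdot]$ denotes the piecewise affine interpolant defined in the context.
   Context: Network. Let $\mathcal I=\{1,\dots,N\}$. The star-shaped network $\Gamma$ is obtained from $N$ copies $\Gamma^\iota$ of $[0,+\infty)$ by identifying all endpoints $0$ with a single vertex $O$. Points are written $(\iota,x)$, with $(\iota,0)=O$. Distance: $d((\iota,x),(\kappa,y))=|x-y|$ if $\iota=\kappa$, $x+y$ otherwise. A function $f$ on $\Gamma$ is identified with the family $f^\iota(x)=f(\iota,x)$. $C(\Gamma)$: all $f^\iota$ continuous on $[0,+\infty)$ with common value $f(O)$ at $0$. $C^2(\Gamma)$: $f\in C(\Gamma)$ with each $f^\iota$ of class $C^2$ on $(0,+\infty)$, derivatives up to order 2 extending continuously to $0$ (vertex derivatives are one-sided and may depend on the edge). $USC(\Gamma)$, $LSC(\Gamma)$: upper/lower semicontinuous functions. Data. $A$ is a compact metric space, $\lambda>0$, $\theta\in\mathbb R$, $\eta\ge0$; $\gamma^\iota>0$ with $\sum_\iota\gamma^\iota=1$; $\sigma^\iota>0$ constants; $b^\iota,f^\iota:[0,+\infty)\times A\to\mathbb R$ are continuous, bounded, and Lipschitz in $x$ uniformly in $a\in A$. Set $H^\iota(x,p)=\sup_{a\in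 A}\{-b^\iota(x,a)p-f^\iota(x,a)\}$. Problem (HJB): $$\begin{cases}-\frac12(\sigma^\iota)^2\partial_{xx}u^\iota+H^\iota(x,\partial_xu^\iota)+\lambda u^\iota=0,& x>0,\ \iota\in\mathcal I,\\ u^\iota(0)=u^\kappa(0)=:u(O),&\iota,\kappa\in\mathcal I,\\ \sum_{\iota\in\mathcal I}\gamma^\iota\sigma^\iota\partial_xu^\iota(0)=\eta(\lambda u(O)-\theta).\end{cases}$$ Viscosity solutions. Let $F^\iota(x,r,p,X)=-\frac12(\sigma^\iota)^2X+H^\iota(x,p)+\lambda r$ and, for $p=(p^\iota)_{\iota}$, $K(r,p)=-\sum_\iota\gamma^\iota\sigma^\iota p^\iota+\eta(\lambda r-\theta)$. A function $u\in USC(\Gamma)$ is a viscosity subsolution if for every $\varphi\in C^2(\Gamma)$ and every local maximum point $x_0$ of $u-\varphi$: if $x_0=(\iota,s_0)$ with $s_0>0$, then $F^\iota(s_0,u(x_0),\partial_x\varphi^\iota(s_0),\partial_{xx}\varphi^\iota(s_0))\le0$; if $x_0=O$, then $$\min\Big\{K\big(u(O),(\partial_x\varphi^\iota(0))_\iota\big),\ \min_{\iota}F^\iota\big(0,u(O),\partial_x\varphi^\iota(0),\partial_{xx}\varphi^\iota(0)\big)\Big\}\le0.$$ A function $u\in LSC(\Gamma)$ is a viscosity supersolution if for every $\varphi\in C^2(\Gamma)$ and every local minimum point $x_0$ of $u-\varphi$: if $x_0=(\iota,s_0)$, $s_0>0$, then $F^\iota(s_0,u(x_0),\partial_x\varphi^\iota(s_0),\partial_{xx}\varphi^\iota(s_0))\ge0$;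 if $x_0=O$, then $$\max\Big\{K\big(u(O),(\partial_x\varphi^\iota(0))_\iota\big),\ \max_{\iota}F^\iota\big(0,u(O),\partial_x\varphi^\iota(0),\partial_{xx}\varphi^\iota(0)\big)\Big\}\ge0.$$ A viscosity solution is $u\in C(\Gamma)$ that is both. It is known (comparison principle) that a bounded viscosity subsolution is $\le$ any bounded viscosity supersolution on $\Gamma$, so the bounded viscosity solution is unique. Scheme. Fix $h_0>0$ with $\sqrt{h_0}\,\sup_{\iota,x,a}|b^\iota(x,a)|\le\min_\iota\sigma^\iota$. For $h\in(0,h_0)$ let $x_j^\iota=j\sigma^\iota\sqrt h$ ($j\ge0$), $\Gamma_h=\{O\}\cup\bigcup_\iota\{(\iota,x^\iota_j):j\ge1\}$, $p^\iota_\pm(x,a)=\frac12\big(1\pm\frac{\sqrt h}{\sigma^\iota}b^\iota(x,a)\big)$, $\rho_h=1-\lambda h$. $\mathcal X_h$ is the space of bounded grid functions $w=(w_0,(w^\iota_j)_{\iota\in\mathcal I,j\ge1})$, where $w_0$ is the value at $O$ and $w_0^\iota:=w_0$. Scheme (S): find $u_h\in\mathcal X_h$ such that, for every $\iota\in\mathcal I$, $j\ge1$, $$u^\iota_{h,j}=\inf_{a\in A}\Big\{hf^\iota(x^\iota_j,a)+\rho_h\big[p^\iota_+(x^\iota_j,a)u^\iota_{h,j+1}+p^\iota_-(x^\iota_j,a)u^\iota_{h,j-1}\big]\Big\},$$ $$u_{h,0}=\frac{\eta\theta h}{\eta+\sqrt h}+\rho_h\Big[\frac{\eta}{\eta+\sqrt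 h}u_{h,0}+\frac{\sqrt h}{\eta+\sqrt h}\sum_{\kappa\in\mathcal I}\gamma^\kappa u^\kappa_{h,1}\Big].$$ For $0<h<\min\{h_0,\lambda^{-1}\}$ this scheme has a unique solution in $\mathcal X_h$. Interpolant. For $w\in\mathcal X_h$, $I_h[w]$ is the continuous function on $\Gamma$ with $I_h[w]^\iota(x)=\frac{x^\iota_{j+1}-x}{\sigma^\iota\sqrt h}w^\iota_j+\frac{x-x^\iota_j}{\sigma^\iota\sqrt h}w^\iota_{j+1}$ for $x\in[x^\iota_j,x^\iota_{j+1}]$, $j\ge0$. *)

(* Defs.v *)
From HB Require Import structures.
From mathcomp Require Import all_boot all_order all_algebra.
From mathcomp Require Import all_classical all_reals all_analysis.
From mathcomp Require Import lra.

Set Warnings "-redundant-canonical-projection".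
Set Implicit Arguments.
Unset Strict Implicit.
Unset Printing Implicit Defensive.

Import Order.TTheory GRing.Theory Num.Theory.
Import numFieldNormedType.Exports.

Local Open Scope classical_set_scope.
Local Open Scope ring_scope.

(* N half-lines [0, +oo[ glued at their endpoints: [None] is the vertex O and
   [Some (i, x)] is the point of edge i at distance x > 0 from O. *)
Definition network (N : nat) (R : realType) : Type :=
  option ('I_N * {x : R | 0 < x}).

HB.instance Definition _ (N : nat) (R : realType) :=
  Choice.on (network N R).

Section Network.
Context {R : realType} {N : nat}.
Implicit Types p q r : network N R.

Definition vertex : network N R := None.

(* (i, x) for x >= 0, so that (i, 0) = O; the value at x < 0 is irrelevant. *)
Definition point (i : 'I_N) (x : R) : network N R := omap (pair i) (insub x).

Definition radius p : R := if p is Some (_, x) then sval x else 0.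

Definition same_edge p q : bool :=
  match p, q with
  | Some (i, _), Some (k, _) => i == k
  | _, _ => true
  end.

Definition network_dist p q : R :=
  if same_edge p q then `|radius p - radius q| else radius p + radius q.

Lemma point0 i : point i 0 = vertex.
Proof. by rewrite /point insubF // ltxx. Qed.

Lemma point_gt0 i x (x0 : 0 < x) : point i x = Some (i, exist _ x x0).
Proof. by rewrite /point (insubT (fun x : R => 0 < x) x0). Qed.

Lemma radius_ge0 p : 0 <= radius p.
Proof. by case: p => [[i [x /= /ltW]]|]. Qed.

Lemma network_dist_point i k x y : 0 <= x -> 0 <= y ->
  network_dist (point i x) (point k y) = if i == k then `|x - y| else x + y.
Proof.
rewrite !le_eqVlt => /predU1P[<-|x0] /predU1P[<-|y0].
- by rewrite !point0 /network_dist /= subrr normr0 addr0 if_same.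
- by rewrite point0 (point_gt0 _ y0) /network_dist /= sub0r normrN gtr0_norm//
    add0r if_same.
- by rewrite point0 (point_gt0 _ x0) /network_dist /= subr0 gtr0_norm//
    addr0 if_same.
- by rewrite (point_gt0 _ x0) (point_gt0 _ y0).
Qed.

Lemma network_distxx p : network_dist p p = 0.
Proof.
by rewrite /network_dist; case: p => [[i x]|] /=; rewrite ?eqxx subrr normr0.
Qed.

Lemma network_dist_eq0 p q : network_dist p q = 0 -> p = q.
Proof.
case: p q => [[i [x x0]]|] [[k [y y0]]|] //; rewrite /network_dist /=.
- case: eqVneq => [->|_].
    move/eqP; rewrite normr_eq0 subr_eq0 => /eqP xy.
    by congr (Some (_, _)); exact: val_inj.
  by move/eqP; rewrite gt_eqF// addr_gt0.
- by move/eqP; rewrite subr0 normr_eq0 gt_eqF.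
- by move/eqP; rewrite sub0r normrN normr_eq0 gt_eqF.
Qed.

Lemma network_dist_sym p q : network_dist p q = network_dist q p.
Proof.
rewrite /network_dist distrC [radius p + _]addrC; congr (if _ then _ else _).
by case: p q => [[i x]|] [[k y]|] //=; rewrite eq_sym.
Qed.

Lemma network_dist_triangle q p r :
  network_dist p r <= network_dist p q + network_dist q r.
Proof.
have le_dist p1 p2 : `|radius p1 - radius p2| <= network_dist p1 p2.
  rewrite /network_dist; case: ifP => // _; have [r1 r2] := (radius_ge0 p1, radius_ge0 p2).
  by rewrite (le_trans (ler_normB _ _))// !ger0_norm.
have le_tri p1 p2 : radius p1 <= radius p2 + `|radius p2 - radius p1|.
  by rewrite -lerBlDl distrC ler_norm.
have dist_le := lerD (le_dist p q) (le_dist q r).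
rewrite {1}/network_dist; case: ifPn => [_|npr].
  exact: le_trans (ler_distD _ _ _) dist_le.
case: (boolP (same_edge p q)) => [pq|npq].
  case: (boolP (same_edge q r)) => [qr|nqr].
    case: q pq qr dist_le => [[k y] pq qr _|_ _ /= ]; last first.
      by rewrite subr0 sub0r normrN !ger0_norm ?radius_ge0.
    case: p r npr pq qr => [[i x]|] [[l z]|] //= /eqP il /eqP ik /eqP kl.
    by case: il; rewrite ik.
  have -> : network_dist q r = radius q + radius r.
    by rewrite /network_dist (negPf nqr).
  have := le_trans (le_tri p q) (lerD (lexx _) (le_dist q p)).
  by rewrite (network_dist_sym q p); lra.
have -> : network_dist p q = radius p + radius q.
  by rewrite /network_dist (negPf npq).
by have := le_trans (le_tri r q) (lerD (lexx _) (le_dist q r)); lra.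
Qed.

End Network.

HB.instance Definition _ (N : nat) (R : realType) :=
  @isMetric.Build R (network N R) (@network_dist R N) (@network_distxx R N)
    (@network_dist_eq0 R N) (@network_dist_sym R N)
    (@network_dist_triangle R N).

Lemma network_ballE (N : nat) (R : realType) (p : network N R) (e : R) :
  ball p e = [set q | network_dist p q < e].
Proof. by []. Qed.

Section FunctionSpaces.
Context {R : realType} {N : nat}.
Implicit Types u phi : network N R -> R.

Definition edge u (i : 'I_N) (x : R) : R := u (point i x).

Definition network_continuous u : Prop :=
  forall i, {within `[0, +oo[, continuous (edge u i)}.

(* k-th derivative along edge i on [0, +oo[: the ordinary one for x > 0,
   extended to the vertex by its right limit. *)
Definition edge_deriv (k : nat) u (i : 'I_N) (x : R) : R :=
  if 0 < x then derive1n k (edge u i) x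
  else lim (derive1n k (edge u i) y @[y --> 0^'+]).

(* Continuity of [edge_deriv k u i] at 0 entails that the limit defining its
   value there exists. *)
Definition network_C2 u : Prop :=
  network_continuous u /\
  forall i,
    [/\ forall x, 0 < x -> derivable (edge u i) x 1,
        forall x, 0 < x -> derivable (derive1 (edge u i)) x 1,
        {within `[0, +oo[, continuous (edge_deriv 1 u i)} &
        {within `[0, +oo[, continuous (edge_deriv 2 u i)}].

Definition network_lsc u : Prop :=
  lower_semicontinuous (fun p => (u p)%:E).

Definition network_usc u : Prop :=
  lower_semicontinuous (fun p => (- u p)%:E).

Definition network_bounded u : Prop := exists M : R, forall p, `|u p| <= M.

Definition local_max (g : network N R -> R) (p : network N R) : Prop :=
  \forall q \near p, g q <= g p.

Definition local_min (g : network N R -> R) (p : network N R) : Prop :=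
  \forall q \near p, g p <= g q.

End FunctionSpaces.

(* Standing assumptions on b^i and f^i; only the values at x >= 0 matter. *)
Definition regular_coef (R : realType) (A : metricType R) (g : R -> A -> R) :=
  [/\ {within `[0, +oo[ `*` [set: A], continuous (fun z => g z.1 z.2)},
      exists M, forall x a, 0 <= x -> `|g x a| <= M &
      exists L, forall a x y, 0 <= x -> 0 <= y ->
        `|g x a - g y a| <= L * `|x - y|].

Section HJB.
Context {R : realType} {N : nat} {A : metricType R}.
Variables (lambda theta eta : R) (gamma sigma : 'I_N -> R).
Variables (b f : 'I_N -> R -> A -> R).
Implicit Types u phi : network N R -> R.

Definition hamiltonian (i : 'I_N) (x p : R) : R :=
  sup [set - b i x a * p - f i x a | a in [set: A]].

Definition edge_op (i : 'I_N) (x r p X : R) : R :=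
  - (2^-1 * sigma i ^+ 2 * X) + hamiltonian i x p + lambda * r.

Definition vertex_op (r : R) (p : 'I_N -> R) : R :=
  - (\sum_i gamma i * sigma i * p i) + eta * (lambda * r - theta).

(* The operators evaluated on the derivatives of a test function. *)
Definition edge_test u phi (i : 'I_N) (x : R) : R :=
  edge_op i x (edge u i x) (edge_deriv 1 phi i x) (edge_deriv 2 phi i x).

Definition vertex_test u phi : R :=
  vertex_op (u vertex) (fun i => edge_deriv 1 phi i 0).

(* [\big[Num.min/K]_i F i] is min {K, min_i F i}. *)
Definition viscosity_sub u : Prop :=
  network_usc u /\
  forall phi, network_C2 phi ->
    (forall i s, 0 < s -> local_max (u \- phi) (point i s) ->
       edge_test u phi i s <= 0) /\
    (local_max (u \- phi) vertex ->
       \big[Num.min/vertex_test u phi]_(i < N) edge_test u phi i 0 <= 0).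

Definition viscosity_super u : Prop :=
  network_lsc u /\
  forall phi, network_C2 phi ->
    (forall i s, 0 < s -> local_min (u \- phi) (point i s) ->
       0 <= edge_test u phi i s) /\
    (local_min (u \- phi) vertex ->
       0 <= \big[Num.max/vertex_test u phi]_(i < N) edge_test u phi i 0).

Definition viscosity_solution u : Prop :=
  [/\ network_continuous u, viscosity_sub u & viscosity_super u].

End HJB.

(* A grid function w: its value at the vertex and, on each edge, the values
   w^i_1, w^i_2, ... (shifted down by one). *)
Record grid_fun (R : realType) (N : nat) := GridFun {
  grid_vertex : R;
  grid_inner : 'I_N -> nat -> R }.

Section Scheme.
Context {R : realType} {N : nat} {A : metricType R}.
Variables (lambda theta eta : R) (gamma sigma : 'I_N -> R).
Variables (b f : 'I_N -> R -> A -> R).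
Implicit Type w : grid_fun R N.

Definition grid_val w (i : 'I_N) (j : nat) : R :=
  if j is k.+1 then grid_inner w i k else grid_vertex w.

Definition grid_bounded w : Prop :=
  exists M : R, `|grid_vertex w| <= M /\ forall i j, `|grid_val w i j| <= M.

Definition grid_step (h : R) (i : 'I_N) : R := sigma i * Num.sqrt h.

Definition grid_pt (h : R) (i : 'I_N) (j : nat) : R := j%:R * grid_step h i.

Definition prob_up (h : R) (i : 'I_N) (x : R) (a : A) : R :=
  2^-1 * (1 + Num.sqrt h / sigma i * b i x a).

Definition prob_down (h : R) (i : 'I_N) (x : R) (a : A) : R :=
  2^-1 * (1 - Num.sqrt h / sigma i * b i x a).

Definition discount (h : R) : R := 1 - lambda * h.

Definition scheme_solution (h : R) w : Prop :=
  [/\ grid_bounded w,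
      forall i j, (1 <= j)%N ->
        let x := grid_pt h i j in
        grid_val w i j =
        inf [set h * f i x a +
               discount h * (prob_up h i x a * grid_val w i j.+1 +
                             prob_down h i x a * grid_val w i j.-1)
            | a in [set: A]] &
      grid_vertex w =
        eta * theta * h / (eta + Num.sqrt h) +
        discount h *
          (eta / (eta + Num.sqrt h) * grid_vertex w +
           Num.sqrt h / (eta + Num.sqrt h) *
             \sum_k gamma k * grid_val w k 1)].

Definition interp_edge (h : R) w (i : 'I_N) (x : R) : R :=
  let j := Num.truncn (x / grid_step h i) in
  (grid_pt h i j.+1 - x) / grid_step h i * grid_val w i j +
  (x - grid_pt h i j) / grid_step h i * grid_val w i j.+1.

Definition interpolant (h : R) w (p : network N R) : R :=
  if p is Some (i, x) then interp_edge h w i (sval x) else grid_vertex w.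

Lemma interpolantE h w i j x : 0 < h -> 0 < sigma i ->
  grid_pt h i j <= x <= grid_pt h i j.+1 ->
  edge (interpolant h w) i x =
  (grid_pt h i j.+1 - x) / grid_step h i * grid_val w i j +
  (x - grid_pt h i j) / grid_step h i * grid_val w i j.+1.
Proof.
move=> h0 si; have s0 : 0 < grid_step h i by rewrite mulr_gt0// sqrtr_gt0.
case/andP; rewrite /grid_pt => jx; rewrite le_eqVlt => xj.
have x0 : 0 <= x by apply: le_trans jx; rewrite mulr_ge0// ltW.
have -> : edge (interpolant h w) i x = interp_edge h w i x.
  move: x0; rewrite /edge le_eqVlt => /predU1P[<-|x0]; last first.
    by rewrite (point_gt0 _ x0).
  rewrite point0 /interp_edge mul0r truncn0 /grid_pt mul0r subrr mul0r mul0r.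
  by rewrite mul1r subr0 addr0 divff ?mul1r// gt_eqF.
rewrite /interp_edge; have sN0 : grid_step h i != 0 by rewrite gt_eqF.
case/predU1P : xj => [->|xj].
  by rewrite mulfK// natrK /grid_pt !subrr !mul0r add0r addr0 -!mulrBl
    !mulfK// -!natrB// !subSnn.
suff -> : Num.truncn (x / grid_step h i) = j by [].
have q0 : 0 <= x / grid_step h i by rewrite divr_ge0// ltW.
by apply/eqP; rewrite truncn_eq// ler_pdivlMr// ltr_pdivrMr// jx.
Qed.

End Scheme.

Definition cvg_locally_uniformly (R : realType) (N : nat)
    (F : R -> network N R -> R) (u : network N R -> R) : Prop :=
  forall p : network N R,
    exists2 U, nbhs p U & {uniform U, F h @[h --> 0^'+] --> u}.

(* Main.v *)
Require Import Defs.
From HB Require Import structures.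
From mathcomp Require Import all_boot all_order all_algebra.
From mathcomp Require Import all_classical all_reals all_analysis.
From mathcomp Require Import ring lra.

Set Implicit Arguments.
Unset Strict Implicit.
Unset Printing Implicit Defensive.

Import Order.TTheory GRing.Theory Num.Theory.
Import numFieldNormedType.Exports.

Local Open Scope classical_set_scope.
Local Open Scope ring_scope.

(** Each edge carries a one-dimensional equation with constant positive
    diffusion, so a viscosity solution is automatically classical; once this is
    known the convergence is a consistency and stability argument, with no
    half-relaxed limits and no comparison principle for semicontinuous
    functions, and it comes with the rate O(sqrt h).

    Regularity.  Call a parabola touching w from above at an interior point a
    test of w.  The viscosity inequalities, tested with edgewise quadratic
    functions only, bound from below the curvature of the parabolas touching
    u, respectively - u, from above, in terms of their slopes.  A steep concave
    parabola is then an upper barrier, which makes u Lipschitz on each edge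
    ([right_lipschitz]).  Slopes of tests are now bounded, hence so are their
    curvatures from below, and a lower bound m for the curvatures is the same as
    a lower bound for second divided differences ([chord_gap_ge]).  Two-sided
    bounds on second divided differences give a derivative d with a quadratic
    remainder ([exists_slope]).  Tests now have slope d, so locally their
    curvature is pinned between values of the Lipschitz function
    g = (H(x, d) + lambda u) / sigma^2; the divided difference argument gives the
    second order expansion of u with a cubic remainder, uniformly on the edge and
    up to the vertex ([second_order_expansion], [viscosity_edge_smooth]).

    Vertex.  The weak min/max condition at O is the classical Kirchhoff condition
    ([viscosity_vertex_condition]): raising all slopes by e > 0 makes room below
    the test function for an arbitrarily concave quadratic term, which forces the
    edge operators to be positive, so that the minimum is nonpositive only
    through the vertex operator; let e tend to 0.

    Scheme.  Inserting the second order expansion, u solves the scheme up to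
    O(h sqrt h) on the edges ([step_value_consistent]) and at the vertex
    ([vertex_value_consistent]).  The scheme is monotone with discount
    1 - lambda h, which yields a discrete comparison principle
    ([discrete_comparison]).  When eta = 0 the vertex equation alone does not
    absorb its residual; the decreasing function Psi = C1 / (1 + x) + C2 does,
    as its negative slope at O produces a gain of order h there while C2 pays
    for it on the edges.  Thus u + sqrt h Psi and u - sqrt h Psi are a discrete
    supersolution and a discrete subsolution, and they enclose u_h
    ([scheme_error]). *)

(* These names are also used by the topology library. *)
Local Notation point := Defs.point.
Local Notation radius := Defs.radius.

(** * Edgewise quadratic test functions *)

(** The only test functions that are needed: a common value at the vertex and
    a quadratic polynomial, with its own coefficients, on each edge. *)
Definition edge_quad (R : realType) (N : nat) (r : R) (p c : 'I_N -> R)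
    (q : network N R) : R :=
  if q is Some (i, x) then r + p i * sval x + c i * sval x ^+ 2 else r.

Section QuadraticTests.
Context {R : realType} {N : nat}.
Variables (r : R) (p c : 'I_N -> R).
Implicit Types (i : 'I_N) (x : R).
Local Notation phi := (edge_quad r p c).

Lemma edge_edge_quad i x : 0 <= x ->
  edge phi i x = r + p i * x + c i * x ^+ 2.
Proof.
rewrite le_eqVlt => /predU1P[<-|x0].
  by rewrite /edge point0 /=; ring.
by rewrite /edge (point_gt0 i x0).
Qed.

Let near_edge i x : 0 < x ->
  \forall y \near x, r + p i * y + c i * y ^+ 2 = edge phi i y.
Proof.
move=> x0; near=> y; rewrite edge_edge_quad// ltW//.
by near: y; exact: lt_nbhsr.
Unshelve. all: by end_near. Qed.

Let is_derive_quad i x : 0 < x ->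
  is_derive x 1 (edge phi i) (p i + c i * 2 * x).
Proof.
move=> x0; apply: (near_eq_is_derive (near_edge i x0)).
apply: is_derive_eq; rewrite /GRing.scale /=; ring.
Qed.

Let near_derive1 i x : 0 < x ->
  \forall y \near x, p i + c i * 2 * y = derive1 (edge phi i) y.
Proof.
move=> x0; near=> y; have y0 : 0 < y by near: y; exact: lt_nbhsr.
by rewrite derive1E (@derive_val _ _ _ _ _ _ _ (is_derive_quad i y0)).
Unshelve. all: by end_near. Qed.

Let is_derive_derive1 i x : 0 < x ->
  is_derive x 1 (derive1 (edge phi i)) (c i * 2).
Proof.
move=> x0; apply: (near_eq_is_derive (near_derive1 i x0)).
apply: is_derive_eq; rewrite /GRing.scale /=; ring.
Qed.

Lemma edge_deriv1_quad i x : 0 <= x ->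
  edge_deriv 1 phi i x = p i + c i * 2 * x.
Proof.
rewrite /edge_deriv derive1n1 le_eqVlt => /predU1P[<-|x0]; last first.
  by rewrite x0 -(nbhs_singleton (near_derive1 i x0)).
rewrite ltxx; apply: cvg_lim => //.
apply: (@cvg_trans _ ((p i + c i * 2 * y) @[y --> 0^'+])).
  apply: near_eq_cvg; near=> y.
  have y0 : 0 < y by near: y; exact: nbhs_right_gt.
  exact: (nbhs_singleton (near_derive1 i y0)).
apply: cvg_at_right_filter.
apply: cvgD; first exact: cvg_cst.
by apply: cvgM; [exact: cvg_cst|exact: cvg_id].
Unshelve. all: by end_near. Qed.

Lemma edge_deriv2_quad i x : 0 <= x -> edge_deriv 2 phi i x = c i * 2.
Proof.
have der y : 0 < y -> derive1n 2 (edge phi i) y = c i * 2.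
  move=> y0; rewrite derive1nS derive1n1 derive1E.
  by rewrite (@derive_val _ _ _ _ _ _ _ (is_derive_derive1 i y0)).
rewrite /edge_deriv le_eqVlt => /predU1P[<-|x0]; last by rewrite x0 der.
rewrite ltxx; apply: lim_near_cst => //; near=> y.
by apply: der; near: y; exact: nbhs_right_gt.
Unshelve. all: by end_near. Qed.

Lemma network_C2_quad : network_C2 phi.
Proof.
have cont g h : (forall x, 0 <= x -> g x = h x) -> continuous h ->
    {within `[(0 : R), +oo[, continuous (g : R -> R)}.
  move=> gh hc; apply: (@subspace_eq_continuous _ _ _ h).
    by move=> x; rewrite inE /= in_itv /= andbT => /gh.
  exact: continuous_subspaceT.
split=> [i|i].
  apply: cont (@edge_edge_quad i) _ => x.
  apply: cvgD; last by apply: cvgM; [exact: cvg_cst|exact: exprn_continuous].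
  by apply: cvgD; [|apply: cvgM]; do ?[exact: cvg_cst|exact: cvg_id].
split.
- by move=> x x0; have [] := is_derive_quad i x0.
- by move=> x x0; have [] := is_derive_derive1 i x0.
- apply: cont (@edge_deriv1_quad i) _ => x.
  by apply: cvgD; [|apply: cvgM]; do ?[exact: cvg_cst|exact: cvg_id].
- by apply: cont (@edge_deriv2_quad i) _ => x; exact: cvg_cst.
Qed.

End QuadraticTests.

(** * Parabolas touching a function of one variable *)

Section TouchingParabolas.
Context {R : realType}.
Implicit Types (w g d : R -> R) (x y z s t p c m M K : R).

(** The parabola with slope [p] and second derivative [2 * c] at [s] touches
    [w] from above at [s]; the condition [0 <= x] keeps the
    whole contact interval inside the edge. *)
Definition touches_above w s p c : Prop :=
  exists x y, [/\ 0 <= x, x < s, s < y &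
    forall t, x < t < y -> w t <= w s + p * (t - s) + c * (t - s) ^+ 2].

(** The second divided difference of [w] at [x], [y], [z], multiplied by
    [(z - x) * (y - z) * (y - x)] so that no denominator occurs; it vanishes on
    affine functions and alternates in its three points. *)
Definition chord_gap w x y z : R :=
  (y - z) * w x + (z - x) * w y - (y - x) * w z.

(** The maximum of [w] minus a quadratic polynomial on a compact interval; when
    it is interior, a vertical translate of the polynomial touches there. *)
Lemma exists_touching_parabola w p c x y : 0 <= x -> x <= y ->
  {within `[0, +oo[, continuous w} ->
  exists2 s, x <= s <= y &
    (forall t, x <= t <= y ->
       w t - (p * t + c * t ^+ 2) <= w s - (p * s + c * s ^+ 2)) /\
    (x < s < y -> touches_above w s (p + c * 2 * s) c).
Proof.
move=> x0 xy wc.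
have gc : {within `[x, y], continuous (fun t => w t - (p * t + c * t ^+ 2))}.
  apply: within_continuousB.
    apply: continuous_subspaceW wc => t /=; rewrite !in_itv /= andbT => /andP[xt _].
    exact: le_trans xt.
  apply: continuous_subspaceT => t.
  apply: cvgD; first by apply: cvgM; [exact: cvg_cst|exact: cvg_id].
  by apply: cvgM; [exact: cvg_cst|exact: exprn_continuous].
have [s sxy smax] := EVT_max xy gc.
have {}smax t : x <= t <= y ->
    w t - (p * t + c * t ^+ 2) <= w s - (p * s + c * s ^+ 2).
  by move=> txy; apply: smax; rewrite in_itv.
exists s; first by move: sxy; rewrite in_itv.
split=> // /andP[xs sy]; exists x, y; split=> // t /andP[xt ty].
have := smax t; rewrite (ltW xt) (ltW ty) => /(_ isT).
have -> : c * t ^+ 2 = c * (t - s) ^+ 2 + c * 2 * s * (t - s) + c * s ^+ 2.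
  by ring.
have -> : (p + c * 2 * s) * (t - s) = p * t - p * s + c * 2 * s * (t - s).
  by ring.
lra.
Qed.

(** If the second divided difference were below [m], lower the curvature of the
    interpolating parabola slightly under [m] while keeping it equal to [w] at
    [x] and [y], so that [w] still exceeds it at [z]; the maximum of the
    difference is then interior and exhibits a touching parabola that is too
    curved. *)
Lemma chord_gap_ge w m x y z : 0 <= x -> x < z -> z < y ->
  {within `[0, +oo[, continuous w} ->
  (forall s p c, x < s < y -> touches_above w s p c -> m <= c) ->
  m * ((z - x) * (y - z) * (y - x)) <= chord_gap w x y z.
Proof.
move=> x0 xz zy wc mtouch; rewrite leNgt; apply/negP => gap_lt.
have xy : x < y by exact: lt_trans zy.
have yx0 : 0 < y - x by rewrite subr_gt0.
have P0 : 0 < (z - x) * (y - z) * (y - x) by rewrite !mulr_gt0 ?subr_gt0.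
set P := (z - x) * (y - z) * (y - x) in gap_lt P0.
(* Half way between [m] and the actual divided difference. *)
pose k := m - (m * P - chord_gap w x y z) / (2 * P).
have km : k < m by rewrite /k gtrDl oppr_lt0 divr_gt0 ?mulr_gt0 ?subr_gt0.
have kP : chord_gap w x y z < k * P.
  have -> : k * P = m * P - (m * P - chord_gap w x y z) / 2.
    by rewrite /k; field; rewrite gt_eqF.
  by lra.
(* [p * t + k * t ^+ 2] is, up to a constant, the parabola of curvature [k]
   through the graph of [w] at [x] and [y]. *)
pose sl := (w y - w x) / (y - x).
have slE : sl * (y - x) = w y - w x by rewrite divfK// gt_eqF.
pose p := sl - k * (x + y).
have [s /andP[xs sy] [smax stouch]] :=
  exists_touching_parabola p k x0 (ltW xy) wc.
have lt_xyz : w x - (p * x + k * x ^+ 2) < w z - (p * z + k * z ^+ 2).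
  rewrite -subr_gt0 -(pmulr_rgt0 _ yx0).
  have -> : (y - x) * (w z - (p * z + k * z ^+ 2) - (w x - (p * x + k * x ^+ 2)))
      = k * P - chord_gap w x y z + (w y - w x - sl * (y - x)) * (z - x).
    by rewrite /p /P /chord_gap; ring.
  by rewrite slE; lra.
have yxE : w y - (p * y + k * y ^+ 2) = w x - (p * x + k * x ^+ 2).
  apply/eqP; rewrite -subr_eq0; apply/eqP.
  transitivity (w y - w x - sl * (y - x)); first by rewrite /p; ring.
  by rewrite slE subrr.
have lt_s : w x - (p * x + k * x ^+ 2) < w s - (p * s + k * s ^+ 2).
  by apply: lt_le_trans lt_xyz (smax _ _); rewrite !ltW.
have sxy : x < s < y.
  rewrite !lt_neqAle xs sy !andbT; apply/andP; split.
    by apply/negP => /eqP xsE; move: lt_s; rewrite xsE ltxx.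
  by apply/negP => /eqP syE; move: lt_s; rewrite syE yxE ltxx.
by have := mtouch _ _ _ sxy (stouch sxy); rewrite leNgt km.
Qed.

(** The barrier is the concave parabola through [(x, w x)] whose slope goes from
    [K] to [K / 2] on an interval of length [r]; its curvature is too negative
    to be a test of [w], and it rises by at least the oscillation of [w]. *)
Lemma right_lipschitz w U B C v : 0 <= U -> 0 <= B -> 0 <= C -> 0 < v ->
  {within `[0, +oo[, continuous w} ->
  (forall x, 0 <= x -> `|w x| <= U) ->
  (forall s p c, touches_above w s p c -> - (B * `|p| + C) <= v * c) ->
  exists2 K, 0 <= K & forall x y, 0 <= x -> x <= y -> w y - w x <= K * (y - x).
Proof.
move=> U0 B0 C0 v0 wc wU wtouch.
have B1 : 0 < 4 * (B + 1) by lra.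
(* With this length, the curvature [- K / (4 * r)] contributes
   [- (B + 1) * K] to the inequality for tests, below the allowed
   [- (B * K + C)]. *)
have [r r0 rE] : exists2 r, 0 < r & r * (4 * (B + 1)) = v.
  exists (v / (4 * (B + 1))); first exact: divr_gt0.
  by rewrite divfK// gt_eqF.
pose K := C + 1 + 4 * U / r.
have Ur0 : 0 <= 4 * U / r by rewrite divr_ge0 ?mulr_ge0// ltW.
have UrE : 4 * U / r * r = 4 * U by rewrite divfK// gt_eqF.
have K0 : 0 < K by rewrite /K; lra.
have KU : 4 * U <= K * r by rewrite -UrE ler_wpM2r// ?ltW// /K; lra.
exists K => [|x y x0 xy]; first exact: ltW.
have near_bound t : x <= t <= x + r -> w t - w x <= K * (t - x).
  pose c := - (K / (4 * r)).
  have c0 : c <= 0 by rewrite oppr_le0 divr_ge0 ?mulr_ge0// ltW.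
  have cr : c * r * 4 = - K by rewrite /c; field; rewrite gt_eqF.
  pose p := K - c * 2 * x.
  have qE s : p * s + c * s ^+ 2 - (p * x + c * x ^+ 2) =
      K * (s - x) + c * (s - x) ^+ 2 by rewrite /p; ring.
  have xr : x <= x + r by rewrite lerDl ltW.
  have [s /andP[xs sr] [smax stouch]] := exists_touching_parabola p c x0 xr wc.
  move=> xtr; have := smax _ xtr => tmax.
  suff : w s - (p * s + c * s ^+ 2) <= w x - (p * x + c * x ^+ 2).
    have := qE t; have : c * (t - x) ^+ 2 <= 0 by exact: mulr_le0_ge0 (sqr_ge0 _).
    by lra.
  have [->//|xNs] := eqVneq s x.
  have [sE|sNr] := eqVneq s (x + r).
    have := wU x x0; have := wU s (le_trans x0 xs); have := qE s.
    have -> : s - x = r by rewrite sE; ring.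
    rewrite !ler_norml.
    have -> : c * r ^+ 2 = c * r * 4 * r / 4 by field.
    by rewrite cr; lra.
  have sxr : x < s < x + r by rewrite !lt_neqAle xs sr eq_sym xNs sNr.
  have := wtouch _ _ _ (stouch sxr).
  set b := _ + _ * s.
  have bE : b = K + c * 2 * (s - x) by rewrite /b /p; ring.
  have b0 : `|b| <= K.
    have csr : c * 2 * r <= c * 2 * (s - x).
      by rewrite ler_wnM2l//; lra.
    have csr0 : c * 2 * (s - x) <= 0 by rewrite mulr_le0_ge0//; lra.
    by rewrite ger0_norm bE; lra.
  have : B * `|b| <= B * K by rewrite ler_wpM2l.
  have : v * c = - (K * (B + 1)).
    transitivity (c * r * 4 * (B + 1)); first by rewrite -rE; ring.
    by rewrite cr mulNr.
  by rewrite /K; lra.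
have [yr|ry] := leP y (x + r); first by apply: near_bound; rewrite xy.
have := wU x x0; have := wU y (le_trans x0 xy); rewrite !ler_norml.
have : K * r <= K * (y - x) by rewrite ler_wpM2l ?(ltW K0)//; lra.
by lra.
Qed.

(** Divide by [e] and let [e] tend to 0. *)
Lemma linear_part_ge0 (a c r : R) : 0 < r ->
  (forall e : R, 0 < e < r -> 0 <= a * e + c * e ^+ 2) -> 0 <= a.
Proof.
move=> r0 ge0; rewrite leNgt; apply/negP => a0.
pose k := Num.max c 1.
have k0 : 0 < k by rewrite lt_max ltr01 orbT.
pose e := Num.min (- a / (2 * k)) (r / 2).
have e0 : 0 < e by rewrite lt_min !divr_gt0 ?mulr_gt0//; lra.
have ek : e * k <= - a / 2.
  apply: (@le_trans _ _ (- a / (2 * k) * k)).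
    by apply: ler_wpM2r; [exact: ltW|rewrite ge_min lexx].
  by rewrite le_eqVlt; apply/orP; left; apply/eqP; field; rewrite gt_eqF.
have er : e < r.
  by apply: (@le_lt_trans _ _ (r / 2)); [rewrite ge_min lexx orbT|lra].
have := ge0 e; rewrite e0 er => /(_ isT).
have : c * e <= k * e by rewrite ler_wpM2r ?(ltW e0)// le_max lexx.
nra.
Qed.

(** Used twice: with [dl = 0] and [M = 0], for a Lipschitz function, it bounds
    the slopes of tests; with [K = 0], for a differentiable one, it identifies
    them. *)
Lemma touch_slope_near w dl K M s p c :
  (forall t, 0 <= t ->
     dl * (t - s) - K * `|t - s| - M * (t - s) ^+ 2 <= w t - w s) ->
  touches_above w s p c -> `|p - dl| <= K.
Proof.
move=> wd [x [y [x0 xs sy tch]]].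
have s0 : 0 <= s by rewrite ltW// (le_lt_trans x0).
rewrite ler_norml -subr_ge0 -[_ && (_ <= K)]andbC -subr_ge0.
apply/andP; split.
  apply: (@linear_part_ge0 _ (c + M) (s - x)); first by rewrite subr_gt0.
  move=> e /andP[e0 ex].
  have := tch (s - e); have := wd (s - e).
  have -> : s - e - s = - e by ring.
  have -> : x < s - e < y by apply/andP; split; lra.
  rewrite normrN (gtr0_norm e0) sqrrN => wd1 /(_ isT).
  have /wd1 : 0 <= s - e by lra.
  by lra.
apply: (@linear_part_ge0 _ (c + M) (y - s)); first by rewrite subr_gt0.
move=> e /andP[e0 ey].
have := tch (s + e); have := wd (s + e).
have -> : s + e - s = e by ring.
have -> : x < s + e < y by apply/andP; split; lra.
rewrite (gtr0_norm e0) => wd1 /(_ isT).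
have /wd1 : 0 <= s + e by lra.
by lra.
Qed.

Lemma chord_gapN w x y z : chord_gap (fun t => - w t) x y z = - chord_gap w x y z.
Proof. by rewrite /chord_gap; ring. Qed.

Lemma within_continuousN_itv w : {within `[0, +oo[, continuous w} ->
  {within `[0, +oo[, continuous (fun t => - w t)}.
Proof. by move=> wc t; apply: cvgN; exact: wc. Qed.

(** Two-sided curvature bounds by the values of one function [g] pin the second
    divided difference near [g s] on an interval where [g] varies little. *)
Lemma chord_gap_le_norm w g G x y z s : 0 <= x -> x < z -> z < y ->
  {within `[0, +oo[, continuous w} ->
  (forall t p c, touches_above w t p c -> g t <= c) ->
  (forall t p c, touches_above (fun t => - w t) t p c -> - g t <= c) ->
  (forall t, x < t < y -> `|g t - g s| <= G) ->
  `|chord_gap w x y z - g s * ((z - x) * (y - z) * (y - x))| <=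
    G * ((z - x) * (y - z) * (y - x)).
Proof.
move=> x0 xz zy wc above below gG.
have := chord_gap_ge x0 xz zy wc (m := g s - G).
have := chord_gap_ge x0 xz zy (within_continuousN_itv wc) (m := - g s - G).
rewrite chord_gapN => lo up.
rewrite ler_norml; apply/andP; split.
  suff /up : forall t p c, x < t < y -> touches_above w t p c -> g s - G <= c.
    by lra.
  move=> t p c /gG; rewrite ler_norml => /andP[] gt _ /above; lra.
suff /lo : forall t p c, x < t < y ->
    touches_above (fun t => - w t) t p c -> - g s - G <= c.
  by lra.
move=> t p c /gG; rewrite ler_norml => /andP[] _ gt /below; lra.
Qed.

(** The bound says that [y |-> (w y - w z) / (y - z)] is [M]-Lipschitz off [z];
    its limit at [z] is obtained as the supremum of its lower envelopes
    [(w y - w z) / (y - z) - M * `|y - z|]. *)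
Lemma exists_slope w M : 0 <= M ->
  (forall x y z, 0 <= x -> x < z -> z < y ->
     `|chord_gap w x y z| <= M * ((z - x) * (y - z) * (y - x))) ->
  exists d, forall z y, 0 <= z -> 0 <= y ->
    `|w y - w z - d z * (y - z)| <= M * (y - z) ^+ 2.
Proof.
move=> M0 gapM.
have {}gapM x y z : 0 <= x -> x <= z -> z <= y ->
    `|chord_gap w x y z| <= M * `|(z - x) * (y - z) * (y - x)|.
  move=> x0; rewrite le_eqVlt => /predU1P[-> _|xz].
    rewrite (_ : chord_gap _ _ _ _ = 0) ?normr0 ?mulr_ge0//.
    by rewrite /chord_gap; ring.
  rewrite le_eqVlt => /predU1P[->|zy].
    rewrite (_ : chord_gap _ _ _ _ = 0) ?normr0 ?mulr_ge0//.
    by rewrite /chord_gap; ring.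
  rewrite [X in _ <= _ * X]gtr0_norm; first exact: gapM.
  by rewrite !mulr_gt0 ?subr_gt0// (lt_trans xz).
have gapM3 x y z : 0 <= x -> 0 <= y -> 0 <= z ->
    `|chord_gap w x y z| <= M * `|(z - x) * (y - z) * (y - x)|.
  pose B a b c : bool :=
    `|chord_gap w a b c| <= M * `|(c - a) * (b - c) * (b - a)|.
  have swapxy a b c : B b a c -> B a b c.
    rewrite /B (_ : chord_gap w b a c = - chord_gap w a b c); last first.
      by rewrite /chord_gap; ring.
    rewrite (_ : _ * _ * (a - b) = - ((c - a) * (b - c) * (b - a))); last by ring.
    by rewrite !normrN.
  have swapyz a b c : B a c b -> B a b c.
    rewrite /B (_ : chord_gap w a c b = - chord_gap w a b c); last first.
      by rewrite /chord_gap; ring.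
    rewrite (_ : _ * _ * (c - a) = - ((c - a) * (b - c) * (b - a))); last by ring.
    by rewrite !normrN.
  move=> x0 y0 z0; rewrite -/(B x y z).
  have [xy|/ltW yx] := leP x y; have [yz|/ltW zy] := leP y z;
    have [xz|/ltW zx] := leP x z.
  - by apply: swapyz; apply: gapM.
  - by apply: swapyz; apply: gapM => //; lra.
  - exact: gapM.
  - by apply: (swapyz); apply: swapxy; apply: (swapyz); apply: gapM.
  - by apply: swapxy; apply: swapyz; apply: gapM.
  - by apply: swapxy; apply: gapM.
  - by apply: swapxy; apply: gapM => //; lra.
  - by apply: swapyz; apply: swapxy; apply: gapM.
suff : forall z, exists dz, 0 <= z -> forall y, 0 <= y ->
    `|w y - w z - dz * (y - z)| <= M * (y - z) ^+ 2.
  by move=> /choice[d dP]; exists d => z y z0 y0; exact: dP.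
move=> z; have [z0|] := leP 0 z; last by exists 0.
pose D y := (w y - w z) / (y - z).
have DM x y : 0 <= x -> 0 <= y -> x != z -> y != z -> `|D x - D y| <= M * `|x - y|.
  move=> x0 y0 xNz yNz.
  have xz0 : x - z != 0 by rewrite subr_eq0.
  have yz0 : y - z != 0 by rewrite subr_eq0.
  have P0 : 0 < `|(x - z) * (y - z)| by rewrite normr_gt0 mulf_neq0.
  rewrite -(ler_pM2r P0) -normrM -mulrA -normrM.
  have -> : (D x - D y) * ((x - z) * (y - z)) = chord_gap w x y z.
    by rewrite /D /chord_gap; field; rewrite ?xz0 ?yz0.
  have -> : (x - y) * ((x - z) * (y - z)) = (z - x) * (y - z) * (y - x) by ring.
  exact: gapM3.
pose E := [set D y - M * `|y - z| | y in [set y | 0 <= y /\ y != z]].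
have ubE y : 0 <= y -> y != z -> ubound E (D y + M * `|y - z|).
  move=> y0 yz _ [x [x0 xz] <-].
  have := DM x y x0 y0 xz yz; rewrite ler_norml => /andP[_].
  have : M * `|x - y| <= M * (`|x - z| + `|y - z|).
    by rewrite ler_wpM2l// (distrC y) ler_distD.
  by lra.
exists (sup E) => _ y y0.
have [->|yz] := eqVneq y z; first by rewrite !subrr mulr0 subr0 normr0 expr0n mulr0.
have E0 : E !=set0 by exists (D y - M * `|y - z|), y.
have lo : D y - M * `|y - z| <= sup E.
  by apply: sup_upper_bound; [split=> //; exists (D y + M * `|y - z|); exact: ubE|exists y].
have up : sup E <= D y + M * `|y - z| by apply: ge_sup => //; exact: ubE.
have -> : w y - w z = D y * (y - z) by rewrite divfK// subr_eq0.
rewrite -mulrBl normrM -[_ ^+ 2]real_normK ?num_real// expr2 mulrA ler_wpM2r//.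
by rewrite ler_norml; apply/andP; split; lra.
Qed.

(** Add the expansions at [z] and at [y]. *)
Lemma slope_lipschitz w d M z y :
  (forall z y, 0 <= z -> 0 <= y ->
    `|w y - w z - d z * (y - z)| <= M * (y - z) ^+ 2) ->
  0 <= z -> 0 <= y -> `|d y - d z| <= 2 * M * `|y - z|.
Proof.
move=> wd z0 y0.
have [->|yz] := eqVneq y z; first by rewrite !subrr normr0 mulr0.
have := wd _ _ z0 y0; have := wd _ _ y0 z0.
have yz0 : 0 < `|y - z| by rewrite normr_gt0 subr_eq0.
move=> /ler_normlP[h1 h2] /ler_normlP[h3 h4].
rewrite -(ler_pM2r yz0) -normrM.
have -> : 2 * M * `|y - z| * `|y - z| = 2 * M * (y - z) ^+ 2.
  by rewrite -[(y - z) ^+ 2]real_normK ?num_real//; ring.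
rewrite ler_norml; apply/andP; split; lra.
Qed.

(** On the interval between [x] and [y] the second divided differences of [w]
    are within [G * `|y - x|] of [g x]; send the intermediate point to [x], where
    the first divided difference tends to [d x]. *)
Lemma second_order_expansion w d g M G x y :
  {within `[0, +oo[, continuous w} ->
  (forall z y, 0 <= z -> 0 <= y ->
    `|w y - w z - d z * (y - z)| <= M * (y - z) ^+ 2) ->
  (forall t p c, touches_above w t p c -> g t <= c) ->
  (forall t p c, touches_above (fun t => - w t) t p c -> - g t <= c) ->
  (forall s t, 0 <= s -> 0 <= t -> `|g s - g t| <= G * `|s - t|) ->
  0 <= x -> 0 <= y ->
  `|w y - w x - d x * (y - x) - g x * (y - x) ^+ 2| <= G * `|y - x| ^+ 3.
Proof.
move=> wc wd above below gG x0 y0.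
have G0 : 0 <= G.
  have := gG 0 1 (lexx _) ler01; rewrite sub0r normrN normr1 mulr1.
  exact: le_trans.
(* The limit [e -> 0], for [y] on either side of [x]: here [T = `|y - x|],
   [W = w y - w x], [v] is the increment of [w] over a step of length [e]
   towards [y], and [dl] its derivative in that direction. *)
have core (T W dl : R) : 0 < T ->
    (forall e, 0 < e < T -> exists2 v, `|v - dl * e| <= M * e ^+ 2 &
      `|e * W - T * v - g x * (e * (T - e) * T)| <= G * T * (e * (T - e) * T)) ->
    `|W - dl * T - g x * T ^+ 2| <= G * T ^+ 3.
  move=> T0 eW; rewrite -subr_ge0.
  apply: (@linear_part_ge0 _ (T * M + `|g x| * T) T) => // e eT.
  have [v] := eW e eT; have /andP[e0 _] := eT.
  set Q := W - _ - _ => h1 h2.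
  have QE : Q * e = (e * W - T * v - g x * (e * (T - e) * T)) +
      T * (v - dl * e) - g x * T * e ^+ 2 by rewrite /Q; ring.
  have : `|Q| * e <= `|e * W - T * v - g x * (e * (T - e) * T)| +
      `|T * (v - dl * e)| + `|g x * T * e ^+ 2|.
    rewrite -[X in _ * X](gtr0_norm e0) -normrM QE.
    by rewrite (le_trans (ler_normB _ _))// lerD2r ler_normD.
  rewrite !normrM !(gtr0_norm T0) !(gtr0_norm e0).
  have : T * `|v - dl * e| <= T * (M * e ^+ 2) by rewrite ler_wpM2l// ltW.
  have : 0 <= G * T * (e * e * T) by rewrite !mulr_ge0// ltW.
  by lra.
have [->|yx] := eqVneq y x.
  by rewrite !subrr mulr0 subr0 expr0n normr0 !mulr0 subr0 normr0 expr0n mulr0.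
have [xy|yx'] := ltP x y.
  have T0 : 0 < y - x by rewrite subr_gt0.
  rewrite (gtr0_norm T0); apply: core => // e /andP[e0 eT].
  exists (w (x + e) - w x).
    have -> : d x * e = d x * (x + e - x) by ring.
    rewrite (_ : e ^+ 2 = (x + e - x) ^+ 2); last by ring.
    by apply: wd; rewrite ?addr_ge0// ltW.
  have -> : e * (y - x - e) * (y - x) = (x + e - x) * (y - (x + e)) * (y - x).
    by ring.
  have -> : e * (w y - w x) - (y - x) * (w (x + e) - w x) =
      chord_gap w x y (x + e) by rewrite /chord_gap; ring.
  apply: chord_gap_le_norm => //; [by rewrite ltrDl|lra|].
  move=> t /andP[xt ty]; apply: (@le_trans _ _ (G * `|t - x|)).
    by apply: gG => //; lra.
  by rewrite ler_wpM2l// ger0_norm; lra.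
have {}yx : y < x by rewrite lt_neqAle yx.
have T0 : 0 < x - y by rewrite subr_gt0.
rewrite (distrC y x) (gtr0_norm T0) (_ : (y - x) ^+ 2 = (x - y) ^+ 2); last by ring.
rewrite (_ : d x * (y - x) = (- d x) * (x - y)); last by ring.
apply: core => // e /andP[e0 eT].
exists (w (x - e) - w x).
  have -> : - d x * e = d x * (x - e - x) by ring.
  rewrite (_ : e ^+ 2 = (x - e - x) ^+ 2); last by ring.
  by apply: wd => //; lra.
have -> : e * (x - y - e) * (x - y) = (x - e - y) * (x - (x - e)) * (x - y).
  by ring.
have -> : e * (w y - w x) - (x - y) * (w (x - e) - w x) =
    chord_gap w y x (x - e) by rewrite /chord_gap; ring.
apply: chord_gap_le_norm => //; [lra|lra|].
move=> t /andP[yt tx]; apply: (@le_trans _ _ (G * `|t - x|)).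
  by apply: gG => //; lra.
by rewrite ler_wpM2l// distrC ger0_norm; lra.
Qed.

End TouchingParabolas.

(** * The Hamiltonian *)

Section Hamiltonian.
Context {R : realType} {N : nat} {A : metricType R}.
Variables (b f : 'I_N -> R -> A -> R) (i : 'I_N) (B F L L' : R).
Hypothesis A0 : [set: A] !=set0.
Hypothesis bB : forall x a, 0 <= x -> `|b i x a| <= B.
Hypothesis fF : forall x a, 0 <= x -> `|f i x a| <= F.
Local Notation H := (hamiltonian b f i).
Implicit Types (x y p q : R) (a : A).

Let integrand_le x p a : 0 <= x -> `|- b i x a * p - f i x a| <= B * `|p| + F.
Proof.
move=> x0; rewrite (le_trans (ler_normB _ _))// lerD ?fF//.
by rewrite mulNr normrN normrM ler_wpM2r ?bB.
Qed.

Let has_sup_integrand x p : 0 <= x ->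
  has_sup [set - b i x a * p - f i x a | a in [set: A]].
Proof.
move=> x0; have [a0 _] := A0; split; first by eexists; exists a0.
exists (B * `|p| + F) => _ [a _ <-].
by rewrite (le_trans (ler_norm _))// integrand_le.
Qed.

Lemma hamiltonian_ge x p a : 0 <= x -> - b i x a * p - f i x a <= H x p.
Proof. by move=> x0; apply: sup_upper_bound; [exact: has_sup_integrand|exists a]. Qed.

Lemma hamiltonian_adherent x p e : 0 <= x -> 0 < e ->
  exists a, H x p - e < - b i x a * p - f i x a.
Proof.
move=> x0 e0; have [_ [a _ <-] ha] := sup_adherent e0 (has_sup_integrand p x0).
by exists a.
Qed.

Lemma hamiltonian_growth x p : 0 <= x -> `|H x p| <= B * `|p| + F.
Proof.
move=> x0; have [a0 _] := A0; rewrite ler_norml; apply/andP; split.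
  apply: le_trans (hamiltonian_ge p a0 x0).
  by have := integrand_le p a0 x0; rewrite ler_norml => /andP[].
apply: ge_sup; first by have [] := has_sup_integrand p x0.
by move=> _ [a _ <-]; rewrite (le_trans (ler_norm _))// integrand_le.
Qed.

Hypothesis bL : forall a x y, 0 <= x -> 0 <= y ->
  `|b i x a - b i y a| <= L * `|x - y|.
Hypothesis fL : forall a x y, 0 <= x -> 0 <= y ->
  `|f i x a - f i y a| <= L' * `|x - y|.

Lemma hamiltonian_lipschitz K x y p q : 0 <= x -> 0 <= y ->
  `|p| <= K -> `|q| <= K ->
  `|H x p - H y q| <= B * `|p - q| + (K * L + L') * `|x - y|.
Proof.
have le_side z t r s : 0 <= z -> 0 <= t -> `|r| <= K ->
    H z s - H t r <= B * `|s - r| + (K * L + L') * `|z - t|.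
  move=> z0 t0 rK; rewrite lerBlDl; apply: ge_sup.
    by have [] := has_sup_integrand s z0.
  move=> _ [a _ <-].
  have -> : - b i z a * s - f i z a = (- b i t a * r - f i t a) -
      (b i z a * (s - r) + (b i z a - b i t a) * r + (f i z a - f i t a)) by ring.
  rewrite lerD ?hamiltonian_ge// (le_trans (ler_norm _))// normrN.
  rewrite (le_trans (ler_normD _ _))// [(K * L + L') * _]mulrDl addrA lerD ?fL//.
  rewrite (le_trans (ler_normD _ _))// !normrM lerD//.
    by rewrite ler_wpM2r// bB.
  by rewrite mulrC -mulrA ler_pM// bL.
move=> x0 y0 pK qK; rewrite ler_norml; apply/andP; split; last exact: le_side.
rewrite lerNl opprB (distrC p) (distrC x); exact: le_side.
Qed.

End Hamiltonian.

(** * Viscosity inequalities as bounds on touching parabolas *)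

Section Neighbourhoods.
Context {R : realType} {N : nat}.
Implicit Types (i : 'I_N) (P : network N R -> Prop).

(** A small ball around an interior point stays inside one edge. *)
Lemma near_point i (x s y : R) P : 0 <= x -> x < s -> s < y ->
  (forall t, x < t < y -> P (point i t)) -> \forall q \near point i s, P q.
Proof.
move=> x0 xs sy ptP; have s0 : 0 < s by exact: le_lt_trans xs.
apply/nbhs_ballP; exists (Num.min (s - x) (y - s)).
  by rewrite /= lt_min !subr_gt0 xs.
rewrite network_ballE => q /=; rewrite lt_min => /andP[qx qy].
case: q qx qy => [[k [t /= t0]]|]; rewrite (point_gt0 _ s0) /network_dist /=.
  have [<-|_] := eqVneq i k; last by lra.
  rewrite !ltr_norml => h1 h2; rewrite -(point_gt0 i t0).
  by apply: ptP; lra.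
by rewrite subr0 gtr0_norm//; lra.
Qed.

Lemma near_vertex (r : R) P : 0 < r -> P vertex ->
  (forall i t, 0 < t < r -> P (point i t)) ->
  \forall q \near (vertex : network N R), P q.
Proof.
move=> r0 Pv ptP; apply/nbhs_ballP; exists r => //.
rewrite network_ballE => -[[k [t /= t0]]|//].
rewrite /network_dist /= sub0r normrN (gtr0_norm t0) => tr.
by rewrite -(point_gt0 k t0); apply: ptP; rewrite t0.
Qed.

End Neighbourhoods.

Section ViscosityTests.
Context {R : realType} {N : nat} {A : metricType R}.
Variables (lambda theta eta : R) (gamma sigma : 'I_N -> R).
Variables (b f : 'I_N -> R -> A -> R).
Variable u : network N R -> R.
Local Notation H := (hamiltonian b f).
Implicit Types (s p c : R).

Let one_edge i (a : R) : 'I_N -> R := fun k => if k == i then a else 0.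

(** The parabola is continued by a constant on the other edges. *)
Lemma viscosity_sub_touch i s p c :
  viscosity_sub lambda theta eta gamma sigma b f u ->
  touches_above (edge u i) s p c ->
  H i s p + lambda * edge u i s <= sigma i ^+ 2 * c.
Proof.
move=> [_ usub] [x [y [x0 xs sy tch]]]; have s0 : 0 < s by exact: le_lt_trans xs.
pose phi := edge_quad 0 (one_edge i (p - c * 2 * s)) (one_edge i c).
have phiE t : 0 <= t -> edge phi i t = (p - c * 2 * s) * t + c * t ^+ 2.
  by move=> t0; rewrite edge_edge_quad// /one_edge eqxx; ring.
have [+ _] := usub phi (network_C2_quad _ _ _).
move=> /(_ i s s0); rewrite /edge_test /edge_op edge_deriv1_quad ?edge_deriv2_quad ?(ltW s0)//.
rewrite /one_edge eqxx subrK.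
have loc : local_max (u \- phi) (point i s).
  apply: (near_point x0 xs sy) => t xty /=.
  have t0 : 0 <= t by rewrite ltW// (le_lt_trans x0)//; case/andP: xty.
  have := tch t xty; have := phiE t t0; have := phiE s (ltW s0).
  by rewrite /edge => -> ->; lra.
by move=> /(_ loc); lra.
Qed.

Lemma viscosity_super_touch i s p c :
  viscosity_super lambda theta eta gamma sigma b f u ->
  touches_above (fun t => - edge u i t) s p c ->
  - (H i s (- p) + lambda * edge u i s) <= sigma i ^+ 2 * c.
Proof.
move=> [_ usup] [x [y [x0 xs sy tch]]]; have s0 : 0 < s by exact: le_lt_trans xs.
pose phi := edge_quad 0 (one_edge i (- p - (- c) * 2 * s)) (one_edge i (- c)).
have phiE t : 0 <= t -> edge phi i t = (- p - (- c) * 2 * s) * t - c * t ^+ 2.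
  by move=> t0; rewrite edge_edge_quad// /one_edge eqxx; ring.
have [+ _] := usup phi (network_C2_quad _ _ _).
move=> /(_ i s s0); rewrite /edge_test /edge_op edge_deriv1_quad ?edge_deriv2_quad ?(ltW s0)//.
rewrite /one_edge eqxx subrK.
have loc : local_min (u \- phi) (point i s).
  apply: (near_point x0 xs sy) => t xty /=.
  have t0 : 0 <= t by rewrite ltW// (le_lt_trans x0)//; case/andP: xty.
  have := tch t xty; have := phiE t t0; have := phiE s (ltW s0).
  by rewrite /edge => -> ->; lra.
by move=> /(_ loc); lra.
Qed.

End ViscosityTests.

(** * Viscosity solutions are classical *)

Section ClassicalRegularity.
Context {R : realType} {N : nat} {A : metricType R}.
Variables (lambda theta eta : R) (gamma sigma : 'I_N -> R).
Variables (b f : 'I_N -> R -> A -> R).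
Variable u : network N R -> R.
Hypothesis A_nonempty : [set: A] !=set0.
Hypothesis lambda_gt0 : 0 < lambda.
Hypothesis sigma_gt0 : forall i, 0 < sigma i.
Hypothesis b_regular : forall i, regular_coef (b i).
Hypothesis f_regular : forall i, regular_coef (f i).
Hypothesis u_bounded : network_bounded u.
Hypothesis u_solution : viscosity_solution lambda theta eta gamma sigma b f u.
Local Notation H := (hamiltonian b f).
Implicit Types (i : 'I_N) (x y s p c C : R) (d : R -> R).

(** Half of the second derivative that the equation prescribes when the first
    one is [d]. *)
Definition half_curvature i d x : R :=
  (H i x (d x) + lambda * edge u i x) / sigma i ^+ 2.

(** Quantitative C^2 regularity up to the vertex, with derivative [d] and a
    Lipschitz second derivative, in the form used for consistency. *)
Definition smooth_edge i d C : Prop :=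
  [/\ forall x, 0 <= x -> `|d x| <= C,
      forall x y, 0 <= x -> 0 <= y ->
        `|edge u i y - edge u i x| <= C * `|y - x|,
      forall x y, 0 <= x -> 0 <= y ->
        `|edge u i y - edge u i x - d x * (y - x)| <= C * (y - x) ^+ 2 &
      forall x y, 0 <= x -> 0 <= y ->
        `|edge u i y - edge u i x - d x * (y - x)
          - half_curvature i d x * (y - x) ^+ 2| <= C * `|y - x| ^+ 3].

Lemma smooth_edge_le i d C C' : C <= C' -> smooth_edge i d C ->
  smooth_edge i d C'.
Proof.
move=> CC [dC wC w1 w2]; split=> [x x0|x y x0 y0|x y x0 y0|x y x0 y0].
- exact: le_trans (dC x x0) CC.
- by apply: le_trans (wC x y x0 y0) _; rewrite ler_wpM2r.
- by apply: le_trans (w1 x y x0 y0) _; rewrite ler_wpM2r ?sqr_ge0.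
- by apply: le_trans (w2 x y x0 y0) _; rewrite ler_wpM2r.
Qed.

(** Bootstrap: Lipschitz bound, then bounded curvature, then existence of the
    derivative, then the curvature given by the equation. *)
Lemma viscosity_edge_smooth i : exists d C, 0 <= C /\ smooth_edge i d C.
Proof.
have [a0 _] := A_nonempty; have [uc usub usup] := u_solution.
have [_ [B bB] [L bL]] := b_regular i; have [_ [F fF] [L' fL]] := f_regular i.
have [U uU] := u_bounded.
have B0 : 0 <= B by exact: le_trans (bB 0 a0 (lexx _)).
have F0 : 0 <= F by exact: le_trans (fF 0 a0 (lexx _)).
have U0 : 0 <= U by exact: le_trans (uU vertex).
have L0 : 0 <= L.
  by have := bL a0 0 1 (lexx _) ler01; rewrite sub0r normrN normr1 mulr1; exact: le_trans.
have L'0 : 0 <= L'.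
  by have := fL a0 0 1 (lexx _) ler01; rewrite sub0r normrN normr1 mulr1; exact: le_trans.
have sg2 : 0 < sigma i ^+ 2 by rewrite exprn_gt0.
set w := edge u i.
have wU x : `|w x| <= U by exact: uU.
have wc : {within `[0, +oo[, continuous w} by exact: uc.
have wNc := within_continuousN_itv wc.
have touch_ge0 v s p c : touches_above v s p c -> 0 <= s.
  by case=> x [y [x0 xs _ _]]; rewrite ltW// (le_lt_trans x0).
pose Q := F + lambda * U.
have Q0 : 0 <= Q by rewrite addr_ge0// mulr_ge0// ltW.
have lwU x : `|lambda * w x| <= lambda * U.
  by rewrite normrM gtr0_norm// ler_wpM2l// ltW.
have growth s p : 0 <= s -> `|H i s p + lambda * w s| <= B * `|p| + Q.
  move=> s0; rewrite addrA (le_trans (ler_normD _ _))// lerD//.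
  exact: hamiltonian_growth.
have above s p c : touches_above w s p c -> - (B * `|p| + Q) <= sigma i ^+ 2 * c.
  move=> tch; apply: le_trans (viscosity_sub_touch usub tch).
  by have := growth s p (touch_ge0 _ _ _ _ tch); rewrite ler_norml => /andP[].
have below s p c : touches_above (fun t => - w t) s p c ->
    - (B * `|p| + Q) <= sigma i ^+ 2 * c.
  move=> tch; apply: le_trans (viscosity_super_touch usup tch).
  rewrite lerN2 -normrN (le_trans (ler_norm _))//.
  exact: growth (touch_ge0 _ _ _ _ tch).
have wNU x : 0 <= x -> `|- w x| <= U by rewrite normrN.
have [K1 K10 wK1] := right_lipschitz U0 B0 Q0 sg2 wc (fun x _ => wU x) above.
have [K2 K20 wK2] := right_lipschitz U0 B0 Q0 sg2 wNc wNU below.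
pose K := K1 + K2.
have K0 : 0 <= K by rewrite addr_ge0.
have wK x y : 0 <= x -> 0 <= y -> `|w y - w x| <= K * `|y - x|.
  suff wKle s t : 0 <= s -> s <= t -> `|w t - w s| <= K * `|t - s|.
    move=> x0 y0; have [xy|/ltW yx] := leP x y; first exact: wKle.
    by rewrite distrC (distrC y); exact: wKle.
  move=> s0 st; have ts : 0 <= t - s by rewrite subr_ge0.
  have := wK1 s t s0 st; have := wK2 s t s0 st.
  have := mulr_ge0 K10 ts; have := mulr_ge0 K20 ts.
  rewrite (ger0_norm ts) ler_norml /K => *; apply/andP; split; lra.
have pK s p c : touches_above w s p c -> `|p| <= K.
  move=> tch; rewrite -(subr0 p).
  apply: (touch_slope_near (M := 0) _ tch) => t t0.
  have := wK s t (touch_ge0 _ _ _ _ tch) t0.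
  by rewrite ler_norml => /andP[]; lra.
have pNK s p c : touches_above (fun t => - w t) s p c -> `|p| <= K.
  move=> tch; rewrite -(subr0 p).
  apply: (touch_slope_near (M := 0) _ tch) => t t0.
  have := wK s t (touch_ge0 _ _ _ _ tch) t0.
  by rewrite ler_norml => /andP[]; lra.
pose M := (B * K + Q) / sigma i ^+ 2.
have M0 : 0 <= M by rewrite divr_ge0 ?(ltW sg2)// addr_ge0// mulr_ge0.
have curv p c : `|p| <= K -> - (B * `|p| + Q) <= sigma i ^+ 2 * c -> - M <= c.
  move=> pleK; rewrite -mulNr ler_pdivrMr// [c * _]mulrC; apply: le_trans.
  by rewrite lerN2 lerD2r ler_wpM2l.
have gapM x y z : 0 <= x -> x < z -> z < y ->
    `|chord_gap w x y z| <= M * ((z - x) * (y - z) * (y - x)).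
  move=> x0 xz zy; rewrite ler_norml; apply/andP; split.
    rewrite -mulNr; apply: chord_gap_ge => // s p c _ tch.
    exact: curv (pK _ _ _ tch) (above _ _ _ tch).
  rewrite -lerN2 -chord_gapN -mulNr; apply: chord_gap_ge => // s p c _ tch.
  exact: curv (pNK _ _ _ tch) (below _ _ _ tch).
have [d wd] := exists_slope M0 gapM.
have dK x : 0 <= x -> `|d x| <= K.
  move=> x0; rewrite ler_norml -[_ && (_ <= K)]andbC -subr_ge0 -[- K <= _]subr_ge0.
  apply/andP; split; apply: (@linear_part_ge0 _ _ M 1) => // e /andP[e0 _].
    have xe : 0 <= x + e by lra.
    have := wd x (x + e) x0 xe; have := wK x (x + e) x0 xe.
    rewrite (_ : x + e - x = e); last by ring.
    by rewrite (gtr0_norm e0) !ler_norml => /andP[_ ?] /andP[? _]; lra.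
  have xe : 0 <= x + e by lra.
  have := wd x (x + e) x0 xe; have := wK x (x + e) x0 xe.
  rewrite (_ : x + e - x = e); last by ring.
  by rewrite (gtr0_norm e0) !ler_norml => /andP[? _] /andP[_ ?]; lra.
have dL := slope_lipschitz wd.
pose G := (B * (2 * M) + (K * L + L') + lambda * K) / sigma i ^+ 2.
have G0 : 0 <= G.
  have lK : 0 <= lambda * K by rewrite mulr_ge0// ltW.
  have BM : 0 <= B * (2 * M) by exact: mulr_ge0 B0 (mulr_ge0 (ler0n _ _) M0).
  have KL : 0 <= K * L by exact: mulr_ge0.
  by apply: divr_ge0 (ltW sg2); rewrite !addr_ge0.
have Gs : G * sigma i ^+ 2 = B * (2 * M) + (K * L + L') + lambda * K.
  by rewrite /G mulfVK// lt0r_neq0.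
have gG s t : 0 <= s -> 0 <= t ->
    `|half_curvature i d s - half_curvature i d t| <= G * `|s - t|.
  move=> s0 t0; rewrite /half_curvature -mulrBl normrM [`|_^-1|]gtr0_norm ?invr_gt0//.
  rewrite ler_pdivrMr// mulrAC Gs.
  have -> : H i s (d s) + lambda * edge u i s - (H i t (d t) + lambda * edge u i t)
    = (H i s (d s) - H i t (d t)) + lambda * (w s - w t) by rewrite /w; ring.
  rewrite (le_trans (ler_normD _ _))// mulrDl lerD//; last first.
    by rewrite normrM gtr0_norm// -mulrA ler_wpM2l ?wK// ltW.
  have := hamiltonian_lipschitz A_nonempty bB fF bL fL s0 t0 (dK s s0) (dK t t0).
  move=> /le_trans; apply; rewrite [leRHS]mulrDl lerD2r -mulrA ler_wpM2l//.
  exact: dL.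
have aboveg s p c : touches_above w s p c -> half_curvature i d s <= c.
  move=> tch; have s0 := touch_ge0 _ _ _ _ tch.
  have := viscosity_sub_touch usub tch.
  suff -> : p = d s by rewrite /half_curvature ler_pdivrMr// [c * _]mulrC.
  apply/eqP; rewrite -subr_eq0 -normr_le0.
  apply: (touch_slope_near (M := M) _ tch) => t t0.
  by have := wd s t s0 t0; rewrite ler_norml mul0r => /andP[]; lra.
have belowg s p c : touches_above (fun t => - w t) s p c -> - half_curvature i d s <= c.
  move=> tch; have s0 := touch_ge0 _ _ _ _ tch.
  have := viscosity_super_touch usup tch.
  suff -> : p = - d s 
    by rewrite opprK /half_curvature -mulNr ler_pdivrMr// [c * _]mulrC.
  apply/eqP; rewrite -subr_eq0 -normr_le0.
  apply: (touch_slope_near (M := M) _ tch) => t t0.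
  by have := wd s t s0 t0; rewrite ler_norml mul0r => /andP[]; lra.
exists d, (K + M + G); split; first by rewrite !addr_ge0.
split=> [x x0|x y x0 y0|x y x0 y0|x y x0 y0].
- by apply: le_trans (dK x x0) _; lra.
- by apply: le_trans (wK x y x0 y0) _; rewrite ler_wpM2r//; lra.
- by apply: le_trans (wd x y x0 y0) _; rewrite ler_wpM2r ?sqr_ge0//; lra.
- apply: le_trans (second_order_expansion wc wd aboveg belowg gG x0 y0) _.
  by rewrite ler_wpM2r//; lra.
Qed.

(** A subsolution is tested with slopes [d i 0 + e] and second derivatives
    [- 2 * c e], a supersolution with [d i 0 - e] and [2 * c (- e)]; the linear
    term dominates near the vertex, so [c] may be as large as is needed to rule
    out the edge operators. *)
Lemma viscosity_vertex_condition (d : 'I_N -> R -> R) C : 0 <= C ->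
  (forall i, smooth_edge i (d i) C) ->
  vertex_op lambda theta eta gamma sigma (u vertex) (fun i => d i 0) = 0.
Proof.
move=> C0 dC; have [_ [_ usub] [_ usup]] := u_solution.
have w1 i t : 0 <= t -> `|u (point i t) - u vertex - d i 0 * t| <= C * t ^+ 2.
  move=> t0; have [_ _ + _] := dC i => /(_ 0 t (lexx _) t0).
  by rewrite subr0 /edge point0.
pose K0 := vertex_op lambda theta eta gamma sigma (u vertex) (fun i => d i 0).
pose S := \sum_i gamma i * sigma i.
have KE e : vertex_op lambda theta eta gamma sigma (u vertex)
    (fun i => d i 0 + e) = K0 - S * e.
  rewrite /K0 /S /vertex_op mulr_suml.
  under eq_bigr do rewrite mulrDr.
  by rewrite big_split /=; ring.
(* Letting [e] tend to 0. *)
have eps_le (v : R) : (forall e : R, 0 < e < 1 -> v - S * e <= 0) -> v <= 0.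
  move=> ve; rewrite -oppr_ge0; apply: (@linear_part_ge0 _ _ S 1) => // e e01.
  have -> : - v * e + S * e ^+ 2 = - (v - S * e) * e by ring.
  by rewrite mulr_ge0 ?oppr_ge0 ?ve//; case/andP: e01 => /ltW.
(* One curvature that works for all edges. *)
pose c e := \sum_i (`|H i 0 (d i 0 + e) + lambda * u vertex| + 1) / sigma i ^+ 2.
have c_ge i e : (`|H i 0 (d i 0 + e) + lambda * u vertex| + 1) / sigma i ^+ 2 <= c e.
  rewrite /c (bigD1 i)//= lerDl sumr_ge0// => k _.
  by rewrite divr_ge0 ?addr_ge0// exprn_ge0// ltW.
have cP i e : `|H i 0 (d i 0 + e) + lambda * u vertex| < sigma i ^+ 2 * c e.
  have := c_ge i e; rewrite ler_pdivrMr ?exprn_gt0// [c e * _]mulrC.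
  by apply: lt_le_trans; rewrite ltrDl.
have c0 e : 0 <= c e.
  by apply: sumr_ge0 => k _; rewrite divr_ge0 ?addr_ge0// exprn_ge0// ltW.
have radius_gt0 e e' : 0 < e -> 0 < e / (C + c e' + 1).
  by move=> e0; rewrite divr_gt0// ltr_wpDl// addr_ge0.
have in_radius e e' t : 0 < t < e / (C + c e' + 1) ->
    C * t ^+ 2 <= e * t - c e' * t ^+ 2.
  move=> /andP[t0]; rewrite ltr_pdivlMr; last by rewrite ltr_wpDl// addr_ge0.
  by move=> te; have := ltr_pM2l t0 (t * (C + c e' + 1)) e; nra.
apply/eqP; rewrite eq_le -[X in _ && X]oppr_le0.
apply/andP; split; apply: eps_le => e /andP[e0 _]; rewrite leNgt; apply/negP.
  pose phi := edge_quad (u vertex) (fun i => d i 0 + e) (fun=> - c e).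
  have [_] := usub phi (network_C2_quad _ _ _).
  suff loc : local_max (u \- phi) vertex.
    move=> /(_ loc); rewrite leNgt => /negP + K0e; apply; apply/bigmin_gtP.
    split=> [|i _].
      rewrite /vertex_test; under eq_fun do rewrite edge_deriv1_quad// mulr0 addr0.
      by rewrite KE.
    rewrite /edge_test /edge_op edge_deriv1_quad// edge_deriv2_quad//.
    rewrite mulr0 addr0 /edge point0.
    by have := cP i e; rewrite ltr_norml => /andP[]; lra.
  apply: (near_vertex (radius_gt0 e e e0)) => // i t te.
  have t0 : 0 <= t by case/andP: te => /ltW.
  have := w1 i t t0; have := in_radius _ _ _ te.
  have := @edge_edge_quad _ _ (u vertex) (fun i => d i 0 + e) (fun=> - c e) i t t0.
  rewrite ler_norml /= -/phi /edge => -> ? /andP[_].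
  by rewrite /phi /=; lra.
pose phi := edge_quad (u vertex) (fun i => d i 0 - e) (fun=> c (- e)).
have [_] := usup phi (network_C2_quad _ _ _).
suff loc : local_min (u \- phi) vertex.
  move=> /(_ loc); rewrite leNgt => /negP + K0e; apply; apply/bigmax_ltP.
  split=> [|i _].
    rewrite /vertex_test; under eq_fun do rewrite edge_deriv1_quad// mulr0 addr0.
    by rewrite KE; move: K0e; rewrite -/K0; lra.
  rewrite /edge_test /edge_op edge_deriv1_quad// edge_deriv2_quad//.
  rewrite mulr0 addr0 /edge point0.
  by have := cP i (- e); rewrite ltr_norml => /andP[]; lra.
apply: (near_vertex (radius_gt0 e (- e) e0)) => // i t te.
have t0 : 0 <= t by case/andP: te => /ltW.
have := w1 i t t0; have := in_radius _ _ _ te.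
have := @edge_edge_quad _ _ (u vertex) (fun i => d i 0 - e) (fun=> c (- e)) i t t0.
rewrite ler_norml /= -/phi /edge => -> ? /andP[? _].
by rewrite /phi /=; lra.
Qed.

End ClassicalRegularity.

(** * Comparison for the scheme *)

Section DiscreteComparison.
Context {R : realType} {N : nat} {A : metricType R}.
Variables (lambda theta eta : R) (gamma sigma : 'I_N -> R).
Variables (b f : 'I_N -> R -> A -> R).
Hypothesis A_nonempty : [set: A] !=set0.
Hypothesis lambda_gt0 : 0 < lambda.
Hypothesis eta_ge0 : 0 <= eta.
Hypothesis gamma_gt0 : forall i, 0 < gamma i.
Hypothesis gamma_sum : \sum_i gamma i = 1.
Hypothesis sigma_gt0 : forall i, 0 < sigma i.
Variable h : R.
Hypothesis h_gt0 : 0 < h.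
Hypothesis lambda_h : lambda * h < 1.
Hypothesis prob_ge0 : forall i x a, 0 <= x ->
  0 <= prob_up sigma b h i x a /\ 0 <= prob_down sigma b h i x a.
Implicit Types (v w : grid_fun R N) (i : 'I_N) (j : nat) (a : A).

Definition step_value w i j a : R :=
  h * f i (grid_pt sigma h i j) a +
  discount lambda h * (prob_up sigma b h i (grid_pt sigma h i j) a * grid_val w i j.+1 +
    prob_down sigma b h i (grid_pt sigma h i j) a * grid_val w i j.-1).

Definition vertex_value w : R :=
  eta * theta * h / (eta + Num.sqrt h) +
  discount lambda h * (eta / (eta + Num.sqrt h) * grid_vertex w +
    Num.sqrt h / (eta + Num.sqrt h) * \sum_k gamma k * grid_val w k 1).

Definition discrete_sub w : Prop :=
  (forall i j, (0 < j)%N -> forall a, grid_val w i j <= step_value w i j a) /\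
  grid_vertex w <= vertex_value w.

(** The infimum over the controls is expressed by almost optimal controls. *)
Definition discrete_super w : Prop :=
  (forall i j, (0 < j)%N -> forall e : R, 0 < e ->
     exists a, step_value w i j a <= grid_val w i j + e) /\
  vertex_value w <= grid_vertex w.

Lemma prob_sum i x a : prob_up sigma b h i x a + prob_down sigma b h i x a = 1.
Proof. by rewrite /prob_up /prob_down; field; rewrite gt_eqF. Qed.

Lemma grid_pt_ge0 i j : 0 <= grid_pt sigma h i j.
Proof. by rewrite mulr_ge0// mulr_ge0 ?sqrtr_ge0// ltW. Qed.

Lemma average_le i j a (y z M : R) : y <= M -> z <= M ->
  prob_up sigma b h i (grid_pt sigma h i j) a * y +
  prob_down sigma b h i (grid_pt sigma h i j) a * z <= M.
Proof.
move=> yM zM; have [pu pd] := prob_ge0 i a (grid_pt_ge0 i j).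
rewrite -[leRHS]mul1r -(prob_sum i (grid_pt sigma h i j) a) mulrDl.
by rewrite lerD// ler_wpM2l.
Qed.

(** The positive part [S] of the supremum of [v - w] satisfies
    [S <= (1 - lambda h) * S], because both sides of the scheme are averages.
    Suprema need not be attained on the infinite grid, hence the argument with
    [sup]. *)
Lemma discrete_comparison v w : grid_bounded v -> grid_bounded w ->
  discrete_sub v -> discrete_super w ->
  grid_vertex v <= grid_vertex w /\
  forall i j, grid_val v i j <= grid_val w i j.
Proof.
move=> [Mv [v0M vM]] [Mw [w0M wM]] [vsub v0sub] [wsup w0sup].
(* Listing the vertex apart makes the set nonempty without choosing an edge. *)
pose E : set R := [set t | t = grid_vertex v - grid_vertex w \/
  exists i j, t = grid_val v i j - grid_val w i j].
have hasE : has_sup E.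
  split; first by exists (grid_vertex v - grid_vertex w); left.
  exists (Mv + Mw) => _ [->|[i [j ->]]].
    by rewrite (le_trans (ler_norm _))// (le_trans (ler_normB _ _))// lerD.
  by rewrite (le_trans (ler_norm _))// (le_trans (ler_normB _ _))// lerD.
pose S := Num.max (sup E) 0.
have S0 : 0 <= S by rewrite le_max lexx orbT.
have ES t : E t -> t <= S.
  by move=> Et; rewrite le_max sup_upper_bound.
have valS i j : grid_val v i j - grid_val w i j <= S by apply: ES; right; exists i, j.
have rho0 : 0 < discount lambda h by rewrite subr_gt0.
have rho1 : discount lambda h < 1 by rewrite /discount gtrBl mulr_gt0.
have E_vertex : grid_vertex v - grid_vertex w <= discount lambda h * S.
  have r0 : 0 < Num.sqrt h by rewrite sqrtr_gt0.
  have q0 : 0 < eta + Num.sqrt h by rewrite ltr_wpDl.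
  have := v0sub; have := w0sup; rewrite /vertex_value.
  set al := eta / _; set be := Num.sqrt h / _.
  have al0 : 0 <= al by rewrite divr_ge0// ltW.
  have be0 : 0 <= be by rewrite divr_ge0// ltW.
  have albe : al + be = 1 by rewrite -mulrDl divff// gt_eqF.
  set sv := \sum_k _ * grid_val v k 1; set sw := \sum_k _ * grid_val w k 1.
  have sS : be * (sv - sw) <= be * S.
    apply: ler_wpM2l => //; rewrite /sv /sw -sumrB -[S]mul1r -gamma_sum mulr_suml.
    by apply: ler_sum => k _; rewrite -mulrBr ler_wpM2l ?valS// ltW.
  have vS : al * (grid_vertex v - grid_vertex w) <= al * S.
    by apply: ler_wpM2l => //; apply: ES; left.
  have : discount lambda h * (al * (grid_vertex v - grid_vertex w) + be * (sv - sw))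
      <= discount lambda h * ((al + be) * S).
    by rewrite ler_pM2l// [leRHS]mulrDl lerD.
  by rewrite albe mul1r; lra.
have E_le t : E t -> t <= discount lambda h * S.
  case=> [->|[i [[|j] ->]]]; [by []|by []|].
  apply/ler_addgt0Pr => e e0.
  have [a wa] := wsup i j.+1 isT e e0; have := vsub i j.+1 isT a.
  have := average_le i j.+1 a (valS i j.+2) (valS i j).
  rewrite -(ler_pM2l rho0); move: wa; rewrite /step_value.
  rewrite [j.+1.-1]/=; lra.
have supE : sup E <= discount lambda h * S by apply: ge_sup E_le; case: hasE.
have S_le0 : S <= 0.
  rewrite leNgt; apply/negP => S_gt0.
  have : S <= discount lambda h * S.
    by rewrite {1}/S ge_max supE mulr_ge0// ltW.
  by apply/negP; rewrite -ltNge gtr_pMl.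
split=> [|i j]; first by rewrite -subr_le0 (le_trans _ S_le0)//; apply: ES; left.
by rewrite -subr_le0 (le_trans _ S_le0).
Qed.

Variable F : R.
Hypothesis fF : forall i x a, 0 <= x -> `|f i x a| <= F.

Lemma scheme_solution_comparable w :
  scheme_solution lambda theta eta gamma sigma b f h w ->
  discrete_sub w /\ discrete_super w.
Proof.
move=> [[M [w0M wM]] weq w0eq].
have has_infw i j : has_inf [set step_value w i j a | a in [set: A]].
  have [a0 _] := A_nonempty; split; first by exists (step_value w i j a0), a0.
  exists (- (h * F) - discount lambda h * M) => _ [a _ <-].
  have rho0 : 0 <= discount lambda h by rewrite subr_ge0 ltW.
  have wN k : - grid_val w i k <= M.
    by rewrite (le_trans (ler_norm _))// normrN.
  have := average_le i j a (wN j.+1) (wN j.-1).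
  move=> /(ler_wpM2l rho0).
  have : h * - f i (grid_pt sigma h i j) a <= h * F.
    apply: ler_wpM2l; first exact: ltW.
    by rewrite (le_trans (ler_norm _))// normrN fF// grid_pt_ge0.
  by rewrite /step_value; lra.
split; (split; last by rewrite [X in _ <= X]w0eq || rewrite [X in X <= _]w0eq).
  move=> i j j0 a; rewrite {1}weq//; apply: ge_inf; last by exists a.
  by have [] := has_infw i j.
move=> i j j0 e e0; have [_ [a _ <-] ae] := inf_adherent e0 (has_infw i j).
by exists a; rewrite [X in _ <= X + _]weq// ltW.
Qed.

End DiscreteComparison.

(** * Consistency and the error bound on the grid *)

Definition sample (R : realType) (N : nat) (sigma : 'I_N -> R) (h : R)
    (g : network N R -> R) : grid_fun R N :=
  GridFun (g vertex) (fun i k => g (point i (grid_pt sigma h i k.+1))).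

(** Bounded and convex, with slope [- C1] at the vertex on every edge. *)
Definition barrier (R : realType) (N : nat) (C1 C2 : R) (p : network N R) : R :=
  C1 / (1 + radius p) + C2.

Section Sampling.
Context {R : realType} {N : nat}.
Variables (sigma : 'I_N -> R) (h : R).
Hypothesis sigma_gt0 : forall i, 0 < sigma i.
Implicit Types (i : 'I_N) (j : nat) (x y : R).

Lemma grid_val_sample g i j :
  grid_val (sample sigma h g) i j = edge g i (grid_pt sigma h i j).
Proof. by case: j => [|j] //=; rewrite /edge /grid_pt mul0r point0. Qed.

Lemma grid_ptS i j :
  grid_pt sigma h i j.+1 = grid_pt sigma h i j + grid_step sigma h i.
Proof. by rewrite /grid_pt -addn1 natrD mulrDl mul1r. Qed.

Lemma grid_bounded_sample g : network_bounded g -> grid_bounded (sample sigma h g).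
Proof.
by case=> M gM; exists M; split=> [|i j]; rewrite ?grid_val_sample; exact: gM.
Qed.

Lemma edge_barrier C1 C2 i x : 0 <= x ->
  edge (barrier C1 C2) i x = C1 / (1 + x) + C2.
Proof.
rewrite le_eqVlt => /predU1P[<-|x0]; first by rewrite /edge point0.
by rewrite /edge (point_gt0 i x0).
Qed.

Lemma barrier_ge C1 C2 (p : network N R) : 0 <= C1 -> C2 <= barrier C1 C2 p.
Proof.
by move=> C10; rewrite lerDr divr_ge0// addr_ge0// Defs.radius_ge0.
Qed.

Lemma barrier_le C1 C2 (p : network N R) : 0 <= C1 -> barrier C1 C2 p <= C1 + C2.
Proof.
move=> C10; have rp := Defs.radius_ge0 p.
have r1 : 0 < 1 + radius p by lra.
rewrite lerD2r ler_pdivrMr// ler_peMr//; lra.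
Qed.

(** First order expansion of [x |-> (1 + x)^-1], whose second derivative is at
    most 2. *)
Lemma inv_one_plus_le x y : 0 <= x -> 0 <= y ->
  (1 + y)^-1 <= (1 + x)^-1 - (1 + x)^-2 * (y - x) + (y - x) ^+ 2.
Proof.
move=> x0 y0; have x1 : 0 < 1 + x by lra.
have y1 : 0 < 1 + y by lra.
have -> : (1 + y)^-1 = (1 + x)^-1 - (1 + x)^-2 * (y - x) +
    (1 + x)^-2 * (1 + y)^-1 * (y - x) ^+ 2.
  by field; rewrite !gt_eqF.
rewrite lerD2l ler_piMl ?sqr_ge0// mulr_ile1 ?invr_ge0 ?exprn_ge0 ?(ltW x1) ?(ltW y1)//.
  by rewrite invf_le1 ?exprn_gt0// exprn_ege1//; lra.
by rewrite invf_le1//; lra.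
Qed.

End Sampling.

Section Consistency.
Context {R : realType} {N : nat} {A : metricType R}.
Variables (lambda theta eta : R) (gamma sigma : 'I_N -> R).
Variables (b f : 'I_N -> R -> A -> R).
Variable u : network N R -> R.
Hypothesis A_nonempty : [set: A] !=set0.
Hypothesis lambda_gt0 : 0 < lambda.
Hypothesis eta_ge0 : 0 <= eta.
Hypothesis gamma_gt0 : forall i, 0 < gamma i.
Hypothesis gamma_sum : \sum_i gamma i = 1.
Hypothesis sigma_gt0 : forall i, 0 < sigma i.
Variables (U B F C sg : R) (d : 'I_N -> R -> R).
Hypothesis uU : forall p, `|u p| <= U.
Hypothesis bB : forall i x a, 0 <= x -> `|b i x a| <= B.
Hypothesis fF : forall i x a, 0 <= x -> `|f i x a| <= F.
Hypothesis C_ge0 : 0 <= C.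
Hypothesis u_smooth : forall i, smooth_edge lambda sigma b f u i (d i) C.
Hypothesis u_vertex :
  vertex_op lambda theta eta gamma sigma (u vertex) (fun i => d i 0) = 0.
Hypothesis sigma_le : forall i, sigma i <= sg.
Variable h : R.
Hypothesis h_gt0 : 0 < h.
Hypothesis h_lambda : lambda * h <= 2^-1.
Hypothesis h_le1 : h <= 1.
Hypothesis h_sigma : sg * Num.sqrt h <= 1.
Hypothesis prob_ge0 : forall i x a, 0 <= x ->
  0 <= prob_up sigma b h i x a /\ 0 <= prob_down sigma b h i x a.
Local Notation r := (Num.sqrt h).
Local Notation H := (hamiltonian b f).
Local Notation step := (step_value lambda sigma b f h).
Implicit Types (i : 'I_N) (j : nat) (a : A) (x : R).

Let r_gt0 : 0 < r. Proof. by rewrite sqrtr_gt0. Qed.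
Let rr : r * r = h. Proof. by rewrite -expr2 sqr_sqrtr// ltW. Qed.
Let r_le1 : r <= 1.
Proof. by rewrite -sqrtr1 ler_sqrt. Qed.
Let lambda_h_le1 : lambda * h <= 1.
Proof. by apply: le_trans h_lambda _; rewrite invf_le1// ler1n. Qed.
Let h_le_r : h <= r. Proof. by rewrite -[leLHS]rr ler_piMl// ltW. Qed.

(** The drift of the random walk over one step is [h * b] and its
    second moment [h * sigma ^+ 2], so the expansion of [u] reproduces the equation up to
    terms of order [h * sqrt h] and [lambda * h * h]. *)
Lemma step_value_consistent i j a : (0 < j)%N ->
  let x := grid_pt sigma h i j in
  `|step (sample sigma h u) i j a -
    (edge u i x + h * (f i x a + b i x a * d i x + H i x (d i x)))| <=
    (2 * (C * sg ^+ 3) + lambda * (B * C + (B * C + F + lambda * U))) * (h * r).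
Proof.
case: j => [//|j] _; cbv zeta; set x := grid_pt _ _ i j.+1; rewrite /step_value !grid_val_sample.
rewrite -/x (grid_ptS _ _ _ j.+1) -/x [j.+1.-1]/=.
set s := grid_step sigma h i.
have xE : grid_pt sigma h i j = x - s by rewrite /x grid_ptS -/s; ring.
have x0 : 0 <= x by exact: grid_pt_ge0.
have s0 : 0 < s by rewrite mulr_gt0.
have xs0 : 0 <= x - s by rewrite -xE grid_pt_ge0.
have xs1 : 0 <= x + s by rewrite addr_ge0// ltW.
rewrite xE; have [dC _ _ w2] := u_smooth i.
have := w2 x (x + s) x0 xs1; have := w2 x (x - s) x0 xs0.
rewrite (_ : x + s - x = s); last by ring.
rewrite (_ : x - s - x = - s); last by ring.
rewrite normrN (gtr0_norm s0).
set w := edge u i x; set g := half_curvature _ _ _ _ _ _ _ _.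
set e1 := edge u i (x - s) - _ - _ - _; set e2 := edge u i (x + s) - _ - _ - _.
have gE : sigma i ^+ 2 * g = H i x (d i x) + lambda * w.
  by rewrite mulrC /g /half_curvature divfK// gt_eqF// exprn_gt0.
move=> e1C e2C.
set P := prob_up _ _ _ _ _ _; set Q := prob_down _ _ _ _ _ _.
have [P0 Q0] := prob_ge0 i a x0; rewrite -/P -/Q in P0 Q0.
have PQ : P + Q = 1 by exact: prob_sum.
have PQs : (P - Q) * s = h * b i x a.
  rewrite -[X in _ = X * _]rr /P /Q /prob_up /prob_down /s /grid_step; field.
  by rewrite gt_eqF.
have ss : s ^+ 2 = h * sigma i ^+ 2 by rewrite /s /grid_step exprMn sqr_sqrtr ?(ltW h_gt0)// mulrC.
set e := P * e2 + Q * e1.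
have s3 : s ^+ 3 <= sg ^+ 3 * (h * r).
  have -> : s ^+ 3 = sigma i ^+ 3 * (h * r) by rewrite /s /grid_step -[X in _ * (X * _)]rr; ring.
  rewrite ler_wpM2r ?mulr_ge0 ?(ltW h_gt0) ?(ltW r_gt0)//.
  by rewrite lerXn2r ?nnegrE ?(ltW (sigma_gt0 i))// (le_trans _ (sigma_le i))// ltW.
have eC : `|e| <= C * sg ^+ 3 * (h * r).
  apply: (@le_trans _ _ (C * s ^+ 3)); last by rewrite -mulrA ler_wpM2l.
  rewrite /e (le_trans (ler_normD _ _))// [`|P * _|]normrM [`|Q * _|]normrM.
  rewrite (ger0_norm P0) (ger0_norm Q0).
  by rewrite -[leRHS]mul1r -PQ mulrDl lerD// ler_wpM2l.
have avg : P * edge u i (x + s) + Q * edge u i (x - s) =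
    w + h * (b i x a * d i x + sigma i ^+ 2 * g) + e.
  have -> : P * edge u i (x + s) + Q * edge u i (x - s) =
    (P + Q) * w + (P - Q) * s * d i x + (P + Q) * (g * s ^+ 2) + e.
    by rewrite /e /e1 /e2 -/w; ring.
  by rewrite PQ PQs ss; ring.
rewrite avg; set D := b i x a * d i x + sigma i ^+ 2 * g.
have -> : h * f i x a + discount lambda h * (w + h * D + e) -
    (w + h * (f i x a + b i x a * d i x + H i x (d i x))) =
    e - lambda * h * e - lambda * h * (h * D).
  by rewrite /discount /D gE; ring.
have DC : `|D| <= B * C + (B * C + F + lambda * U).
  rewrite (le_trans (ler_normD _ _))// lerD//.
    by rewrite normrM ler_pM// ?bB ?dC.
  rewrite gE (le_trans (ler_normD _ _))// lerD//.
    apply: le_trans (hamiltonian_growth A_nonempty (@bB i) (@fF i) _ x0) _.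
    rewrite lerD2r ler_wpM2l ?dC//.
    by have [a0 _] := A_nonempty; apply: le_trans (bB i a0 (lexx 0)).
  by rewrite normrM gtr0_norm// ler_wpM2l ?(ltW lambda_gt0)//; exact: uU.
have lh0 : 0 <= lambda * h by rewrite mulr_ge0// ltW.
rewrite (le_trans (ler_normB _ _))// [leRHS]mulrDl lerD//.
  rewrite (le_trans (ler_normB _ _))// normrM (ger0_norm lh0).
  have : lambda * h * `|e| <= `|e| by rewrite ler_piMl.
  by lra.
rewrite normrM (ger0_norm lh0) normrM (gtr0_norm h_gt0) -mulrA -mulrA.
rewrite ler_wpM2l ?(ltW lambda_gt0)//.
have -> : h * (h * `|D|) = `|D| * (h * h) by ring.
rewrite ler_pM// ?mulr_ge0 ?(ltW h_gt0)//.
by rewrite ler_wpM2l ?(ltW h_gt0).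
Qed.

(** The average of the barrier over one step grows by at most
    [C1 * (B + sg ^+ 2) * h], which the discount of the constant [C2]
    compensates. *)
Lemma barrier_step_le i j a C1 C2 K : 0 <= C1 -> (0 < j)%N ->
  0 <= C2 -> K + C1 * (B + sg ^+ 2) <= lambda * C2 ->
  let x := grid_pt sigma h i j in
  discount lambda h *
    (prob_up sigma b h i x a * grid_val (sample sigma h (barrier C1 C2)) i j.+1 +
     prob_down sigma b h i x a * grid_val (sample sigma h (barrier C1 C2)) i j.-1)
  <= edge (barrier C1 C2) i x - K * h.
Proof.
move=> C10; case: j => [//|j] _ C20 KC2; cbv zeta.
set x := grid_pt _ _ i j.+1; rewrite !grid_val_sample.
rewrite (grid_ptS _ _ _ j.+1) -/x [j.+1.-1]/=.
set s := grid_step sigma h i.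
have xE : grid_pt sigma h i j = x - s by rewrite /x grid_ptS -/s; ring.
have x0 : 0 <= x by exact: grid_pt_ge0.
have s0 : 0 < s by rewrite mulr_gt0.
have xs0 : 0 <= x - s by rewrite -xE grid_pt_ge0.
have xs1 : 0 <= x + s by rewrite addr_ge0// ltW.
rewrite xE !edge_barrier//.
set P := prob_up _ _ _ _ _ _; set Q := prob_down _ _ _ _ _ _.
have [P0 Q0] := prob_ge0 i a x0; rewrite -/P -/Q in P0 Q0.
have PQ : P + Q = 1 by exact: prob_sum.
have PQs : (P - Q) * s = h * b i x a.
  rewrite -[X in _ = X * _]rr /P /Q /prob_up /prob_down /s /grid_step; field.
  by rewrite gt_eqF.
have ss : s ^+ 2 <= h * sg ^+ 2.
  have -> : s ^+ 2 = h * sigma i ^+ 2.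
    by rewrite /s /grid_step exprMn sqr_sqrtr ?(ltW h_gt0)// mulrC.
  rewrite ler_wpM2l ?(ltW h_gt0)// lerXn2r ?nnegrE ?(ltW (sigma_gt0 i))//.
  by rewrite (le_trans _ (sigma_le i))// ltW.
set k := (1 + x)^-2.
have k0 : 0 <= k by rewrite invr_ge0 exprn_ge0// addr_ge0.
have k1 : k <= 1.
  by rewrite invf_le1 ?exprn_gt0 ?exprn_ege1//; lra.
have avg : P * (1 + (x + s))^-1 + Q * (1 + (x - s))^-1 <=
    (1 + x)^-1 + h * (B + sg ^+ 2).
  have := ler_wpM2l P0 (inv_one_plus_le x0 xs1).
  have := ler_wpM2l Q0 (inv_one_plus_le x0 xs0).
  rewrite (_ : x + s - x = s); last by ring.
  rewrite (_ : x - s - x = - s); last by ring.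
  rewrite -/k sqrrN; set v := (1 + x)^-1 => h1 h2.
  apply: le_trans (lerD h2 h1) _.
  have -> : P * (v - k * s + s ^+ 2) + Q * (v - k * - s + s ^+ 2) =
      (P + Q) * v - k * ((P - Q) * s) + (P + Q) * s ^+ 2 by ring.
  rewrite PQ PQs !mul1r [h * (_ + _)]mulrDr addrA lerD// lerD2l.
  have -> : - (k * (h * b i x a)) = h * (k * - b i x a) by ring.
  rewrite ler_wpM2l ?(ltW h_gt0)// (le_trans (ler_norm _))// normrM normrN ger0_norm//.
  by rewrite -[leRHS]mul1r ler_pM// bB.
set V := C1 / (1 + x) + C2.
have V_ge : C2 <= V by rewrite /V lerDr divr_ge0// addr_ge0.
have avgV : P * (C1 / (1 + (x + s)) + C2) + Q * (C1 / (1 + (x - s)) + C2) <=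
    V + C1 * (h * (B + sg ^+ 2)).
  have := ler_wpM2l C10 avg; rewrite mulrDr => avg1.
  have -> : P * (C1 / (1 + (x + s)) + C2) + Q * (C1 / (1 + (x - s)) + C2) =
    C1 * (P * (1 + (x + s))^-1 + Q * (1 + (x - s))^-1) + (P + Q) * C2 by ring.
  by rewrite PQ /V; lra.
have rho0 : 0 <= discount lambda h by rewrite subr_ge0.
have B0 : 0 <= B by exact: le_trans (bB i a x0).
have lh0 : 0 <= lambda * h by rewrite mulr_ge0// ltW.
apply: le_trans (ler_wpM2l rho0 avgV) _.
have : lambda * h * (C1 * (h * (B + sg ^+ 2))) >= 0.
  by rewrite !mulr_ge0 ?(ltW h_gt0)// ?addr_ge0 ?sqr_ge0// ltW.
have : lambda * h * C2 <= lambda * h * V by rewrite ler_wpM2l.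
have := ler_wpM2r (ltW h_gt0) KC2.
rewrite /discount; lra.
Qed.

(** The part of the vertex equation that is linear in the grid function, after
    multiplication by [eta + sqrt h]. *)
Definition vertex_form (w : grid_fun R N) : R :=
  discount lambda h * ((eta + r) * grid_vertex w +
    r * \sum_k gamma k * (grid_val w k 1 - grid_vertex w)) -
  (eta + r) * grid_vertex w.

Lemma vertex_valueE w :
  (eta + r) * (vertex_value lambda theta eta gamma h w - grid_vertex w) =
  eta * theta * h + vertex_form w.
Proof.
have q0 : eta + r != 0 by rewrite gt_eqF// ltr_wpDl.
rewrite /vertex_value /vertex_form.
have -> : \sum_k gamma k * grid_val w k 1 =
    grid_vertex w + \sum_k gamma k * (grid_val w k 1 - grid_vertex w).
  rewrite -[X in X + _]mul1r -gamma_sum mulr_suml -big_split /=.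
  by apply: eq_bigr => k _; ring.
set S := \sum_k _.
by field.
Qed.

(** The terms of order [h] add up to the Kirchhoff condition. *)
Lemma vertex_value_consistent :
  `|eta * theta * h + vertex_form (sample sigma h u)| <=
    (lambda * U + lambda * (sg * C) + C * sg ^+ 2) * (h * r).
Proof.
pose D := \sum_k gamma k * sigma k * d k 0.
have DE : D = eta * (lambda * u vertex - theta).
  by move: u_vertex; rewrite /vertex_op -/D => /eqP; rewrite addrC subr_eq0 => /eqP.
pose e := \sum_k gamma k * (edge u k (grid_step sigma h k) - u vertex) - r * D.
have eC : `|e| <= C * sg ^+ 2 * h.
  rewrite /e /D mulr_sumr -sumrB (le_trans (ler_norm_sum _ _ _))//.
  rewrite -[leRHS]mul1r -gamma_sum mulr_suml; apply: ler_sum => k _.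
  have s0 : 0 <= grid_step sigma h k by rewrite mulr_ge0 ?ltW.
  have -> : gamma k * (edge u k (grid_step sigma h k) - u vertex) -
      r * (gamma k * sigma k * d k 0) =
      gamma k * (edge u k (grid_step sigma h k) - edge u k 0 -
        d k 0 * (grid_step sigma h k - 0)).
    by rewrite /edge point0 /grid_step; ring.
  rewrite normrM gtr0_norm// ler_wpM2l ?(ltW (gamma_gt0 k))//.
  have [_ _ w1 _] := u_smooth k; apply: le_trans (w1 0 _ (lexx _) s0) _.
  rewrite subr0 -mulrA ler_wpM2l// /grid_step exprMn sqr_sqrtr ?(ltW h_gt0)//.
  rewrite ler_wpM2r ?(ltW h_gt0)// lerXn2r ?nnegrE ?(ltW (sigma_gt0 k))//.
  by rewrite (le_trans _ (sigma_le k))// ltW.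
have DC : `|D| <= sg * C.
  rewrite /D (le_trans (ler_norm_sum _ _ _))//.
  rewrite -[leRHS]mul1r -gamma_sum mulr_suml; apply: ler_sum => k _.
  rewrite -mulrA 2!normrM (gtr0_norm (gamma_gt0 k)) (gtr0_norm (sigma_gt0 k)).
  rewrite ler_wpM2l ?(ltW (gamma_gt0 k))//.
  by rewrite ler_pM ?(ltW (sigma_gt0 k))//; have [dC _ _ _] := u_smooth k; exact: dC.
rewrite /vertex_form /=.
have -> : \sum_k gamma k * (u (point k (grid_pt sigma h k 1)) - u vertex) = r * D + e.
  by rewrite /e addrC subrK; apply: eq_bigr => k _; rewrite /grid_pt mul1r.
have -> : r * (r * D + e) = h * D + r * e by rewrite mulrDr mulrA rr.
have -> : eta * theta * h + (discount lambda h * ((eta + r) * u vertex + (h * D + r * e)) -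
    (eta + r) * u vertex) =
    h * (D - eta * (lambda * u vertex - theta)) - lambda * u vertex * (h * r)
    - lambda * D * (h * h) + discount lambda h * e * r.
  by rewrite /discount; ring.
rewrite DE subrr mulr0 sub0r -DE.
have lh0 : 0 <= lambda * h by rewrite mulr_ge0// ltW.
have hr0 : 0 <= h * r by apply: mulr_ge0; exact: ltW.
rewrite (le_trans (ler_normD _ _))// [leRHS]mulrDl lerD//.
  rewrite (le_trans (ler_normB _ _))// [leRHS]mulrDl lerD//.
    rewrite normrN normrM (ger0_norm hr0) ler_wpM2r//.
    by rewrite normrM gtr0_norm// ler_wpM2l ?uU// ltW.
  rewrite normrM ler_pM// normrM.
    by rewrite gtr0_norm// ler_wpM2l ?(ltW lambda_gt0).
  by rewrite gtr0_norm// ler_wpM2l ?(ltW h_gt0).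
rewrite !normrM (gtr0_norm r_gt0) mulrA ler_wpM2r ?(ltW r_gt0)//.
apply: le_trans eC; rewrite ler_piMl//.
by rewrite ler_norml /discount; have := lambda_h_le1 => ?; apply/andP; split; lra.
Qed.

(** The gain comes from the negative slope of the barrier alone and hence does
    not depend on [eta]. *)
Lemma barrier_vertex_le C1 C2 : 0 <= C1 -> 0 <= C2 ->
  vertex_form (sample sigma h (barrier C1 C2)) <=
  - (C1 * (\sum_k gamma k * sigma k) / 4 * h).
Proof.
move=> C10 C20; rewrite /vertex_form /=; set V := barrier C1 C2 vertex.
have V0 : 0 <= V by apply: le_trans (barrier_ge _ _ _).
have sum_le : \sum_k gamma k * (barrier C1 C2 (point k (grid_pt sigma h k 1)) - V)
    <= - (C1 * (\sum_k gamma k * sigma k) / 2 * r).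
  have -> : - (C1 * (\sum_k gamma k * sigma k) / 2 * r) =
      \sum_k gamma k * - (C1 * sigma k * r / 2).
    rewrite mulr_sumr !mulr_suml -sumrN; apply: eq_bigr => k _; ring.
  apply: ler_sum => k _; rewrite ler_wpM2l ?(ltW (gamma_gt0 k))//.
  have s0 : 0 < sigma k * r by rewrite mulr_gt0.
  have s1 : sigma k * r <= 1.
    by rewrite (le_trans _ h_sigma)// ler_wpM2r// ltW.
  rewrite [grid_pt _ _ _ _]mul1r -/(edge (barrier C1 C2) k _) edge_barrier; last exact: ltW.
  rewrite /V /barrier /= /grid_step addr0 divr1; set t := sigma k * r.
  have t1 : 0 < 1 + t by rewrite ltr_wpDl// ltW.
  have t_le1 : t <= 1 by [].
  have -> : C1 / (1 + t) + C2 - (C1 + C2) = - (C1 * (t / (1 + t))).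
    by field; rewrite gt_eqF.
  have -> : C1 * sigma k * r / 2 = C1 * (t / 2) by rewrite /t; ring.
  rewrite lerN2 ler_wpM2l// ler_wpM2l ?(ltW s0)//.
  by rewrite lef_pV2 ?posrE//; lra.
have q0 : 0 < eta + r by rewrite ltr_wpDl.
have lh0 : 0 <= lambda * h by rewrite mulr_ge0// ltW.
set S := \sum_k _ in sum_le *; set T := \sum_k _ in sum_le *.
have T0 : 0 <= T.
  by apply: sumr_ge0 => k _; rewrite mulr_ge0 ?ltW.
have CT : 0 <= C1 * T by rewrite mulr_ge0.
have rS : r * S <= - (C1 * T / 2 * h).
  have rE : r * - (C1 * T / 2 * r) = - (C1 * T / 2 * h).
    by rewrite -[X in _ = - (_ * X)]rr; ring.
  by rewrite -rE ler_wpM2l ?(ltW r_gt0).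
have rS0 : - (C1 * T / 2 * h) <= 0 by rewrite oppr_le0 mulr_ge0 ?divr_ge0// ltW.
have lqV : 0 <= lambda * h * ((eta + r) * V) by rewrite !mulr_ge0// ltW.
have : (1 - lambda * h) * (r * S) <= 2^-1 * (r * S).
  rewrite ler_wnM2r//; first exact: le_trans rS rS0.
  by have := h_lambda; lra.
rewrite /discount; lra.
Qed.

Variables C1 C2 : R.
Hypothesis C1_ge0 : 0 <= C1.
Hypothesis C2_ge0 : 0 <= C2.
Hypothesis C1_large :
  lambda * U + lambda * (sg * C) + C * sg ^+ 2 <=
  C1 * (\sum_k gamma k * sigma k) / 4.
Hypothesis C2_large :
  2 * (C * sg ^+ 3) + lambda * (B * C + (B * C + F + lambda * U)) +
  C1 * (B + sg ^+ 2) <= lambda * C2.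

Definition perturbed (t : R) (p : network N R) : R :=
  u p + t * (r * barrier C1 C2 p).

Let step_perturbed t i j a :
  step (sample sigma h (perturbed t)) i j a = step (sample sigma h u) i j a +
    t * (r * (discount lambda h *
      (prob_up sigma b h i (grid_pt sigma h i j) a *
         grid_val (sample sigma h (barrier C1 C2)) i j.+1 +
       prob_down sigma b h i (grid_pt sigma h i j) a *
         grid_val (sample sigma h (barrier C1 C2)) i j.-1))).
Proof.
by rewrite /step_value !grid_val_sample /edge /perturbed; ring.
Qed.

Let vertex_form_perturbed t :
  vertex_form (sample sigma h (perturbed t)) = vertex_form (sample sigma h u) +
    t * (r * vertex_form (sample sigma h (barrier C1 C2))).
Proof.
rewrite /vertex_form.
have -> : \sum_k gamma k * (grid_val (sample sigma h (perturbed t)) k 1 -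
      grid_vertex (sample sigma h (perturbed t))) =
    \sum_k gamma k * (grid_val (sample sigma h u) k 1 -
      grid_vertex (sample sigma h u)) +
    t * (r * \sum_k gamma k * (grid_val (sample sigma h (barrier C1 C2)) k 1 -
      grid_vertex (sample sigma h (barrier C1 C2)))).
  rewrite !mulr_sumr -big_split /=; apply: eq_bigr => k _.
  by rewrite /perturbed; ring.
set X := \sum_k _; set Y := \sum_k _; rewrite /= /perturbed; ring.
Qed.

Let hr_ge0 : 0 <= h * r. Proof. by apply: mulr_ge0; exact: ltW. Qed.

Let barrier_vertex_small :
  r * vertex_form (sample sigma h (barrier C1 C2)) <=
    - ((lambda * U + lambda * (sg * C) + C * sg ^+ 2) * (h * r)).
Proof.
have := ler_wpM2l (ltW r_gt0) (barrier_vertex_le C1_ge0 C2_ge0).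
have := ler_wpM2r hr_ge0 C1_large; lra.
Qed.

Let barrier_step_small i j a : (0 < j)%N ->
  r * (discount lambda h *
      (prob_up sigma b h i (grid_pt sigma h i j) a *
         grid_val (sample sigma h (barrier C1 C2)) i j.+1 +
       prob_down sigma b h i (grid_pt sigma h i j) a *
         grid_val (sample sigma h (barrier C1 C2)) i j.-1)) <=
  r * edge (barrier C1 C2) i (grid_pt sigma h i j) -
  (2 * (C * sg ^+ 3) + lambda * (B * C + (B * C + F + lambda * U))) * (h * r).
Proof.
move=> j0; have := ler_wpM2l (ltW r_gt0) (barrier_step_le i a C1_ge0 j0 C2_ge0 C2_large).
by move=> /le_trans; apply; rewrite le_eqVlt; apply/orP; left; apply/eqP; ring.
Qed.

Lemma perturbed_super : discrete_super lambda theta eta gamma sigma b f h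
  (sample sigma h (perturbed 1)).
Proof.
split=> [i j j0 e e0|].
  set x := grid_pt sigma h i j.
  have x0 : 0 <= x by exact: grid_pt_ge0.
  have [a aH] := hamiltonian_adherent A_nonempty (@bB i) (@fF i) (d i x) x0
    (divr_gt0 e0 h_gt0).
  have {}aH : h * (f i x a + b i x a * d i x + H i x (d i x)) <= e.
    by rewrite mulrC -ler_pdivlMr//; lra.
  exists a; rewrite step_perturbed [grid_val (sample _ _ (perturbed _)) _ _]grid_val_sample.
  rewrite -/x mul1r.
  have := step_value_consistent i a j0; cbv zeta; rewrite -/x.
  have := barrier_step_small i a j0; rewrite -/x.
  have -> : edge (perturbed 1) i x = edge u i x + r * edge (barrier C1 C2) i x.
    by rewrite /edge /perturbed mul1r.
  rewrite ler_norml => ? /andP[_]; lra.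
have q0 : 0 < eta + r by rewrite ltr_wpDl.
rewrite -subr_le0 -(pmulr_rle0 _ q0) vertex_valueE vertex_form_perturbed mul1r.
have := vertex_value_consistent; rewrite ler_norml => /andP[_].
by have := barrier_vertex_small; lra.
Qed.

Lemma perturbed_sub : discrete_sub lambda theta eta gamma sigma b f h
  (sample sigma h (perturbed (-1))).
Proof.
split=> [i j j0 a|].
  set x := grid_pt sigma h i j.
  have x0 : 0 <= x by exact: grid_pt_ge0.
  have aH := hamiltonian_ge A_nonempty (@bB i) (@fF i) (d i x) a x0.
  have {}aH : 0 <= h * (f i x a + b i x a * d i x + H i x (d i x)).
    by rewrite mulr_ge0 ?(ltW h_gt0)//; lra.
  rewrite step_perturbed [grid_val (sample _ _ (perturbed _)) _ _]grid_val_sample.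
  rewrite -/x mulN1r.
  have := step_value_consistent i a j0; cbv zeta; rewrite -/x.
  have := barrier_step_small i a j0; rewrite -/x.
  have -> : edge (perturbed (-1)) i x = edge u i x - r * edge (barrier C1 C2) i x.
    by rewrite /edge /perturbed mulN1r.
  rewrite ler_norml => ? /andP[+ _]; lra.
have q0 : 0 < eta + r by rewrite ltr_wpDl.
rewrite -subr_ge0 -(pmulr_rge0 _ q0) vertex_valueE vertex_form_perturbed mulN1r.
have := vertex_value_consistent; rewrite ler_norml => /andP[+ _].
by have := barrier_vertex_small; lra.
Qed.

Lemma perturbed_bounded t : grid_bounded (sample sigma h (perturbed t)).
Proof.
apply: grid_bounded_sample; exists (U + `|t * r| * (C1 + C2)) => p.
rewrite (le_trans (ler_normD _ _))// lerD ?uU// mulrA normrM ler_wpM2l//.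
have b0 := barrier_ge C2 p C1_ge0.
by rewrite ger0_norm ?barrier_le// (le_trans C2_ge0).
Qed.

(** The scheme solution is enclosed between the two perturbations of [u]. *)
Lemma scheme_error w i j :
  scheme_solution lambda theta eta gamma sigma b f h w ->
  `|grid_val w i j - edge u i (grid_pt sigma h i j)| <= (C1 + C2) * r.
Proof.
move=> sw; have [wb _ _] := sw.
have lh : lambda * h < 1.
  by apply: le_lt_trans h_lambda _; rewrite invf_lt1// ltr1n.
have [wsub wsup] :=
  scheme_solution_comparable A_nonempty sigma_gt0 h_gt0 lh prob_ge0 fF sw.
have comp := discrete_comparison lambda_gt0 eta_ge0 gamma_gt0 gamma_sum
  sigma_gt0 h_gt0 lh prob_ge0.
have [_ /(_ i j) up] := comp _ _ _ _ wb (perturbed_bounded 1) wsub perturbed_super.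
have [_ /(_ i j) lo] := comp _ _ _ _ (perturbed_bounded (-1)) wb perturbed_sub wsup.
rewrite !grid_val_sample /edge /perturbed in up lo.
have := ler_wpM2r (ltW r_gt0)
  (barrier_le C2 (point i (grid_pt sigma h i j)) C1_ge0).
by rewrite ler_norml /edge => ?; apply/andP; split; lra.
Qed.

End Consistency.

(** * Interpolation and convergence *)

Lemma finite_bound (R : realType) (N : nat) (P : 'I_N -> R -> Prop) :
  (forall i C C', C <= C' -> P i C -> P i C') ->
  (forall i, exists C, 0 <= C /\ P i C) -> exists C, 0 <= C /\ forall i, P i C.
Proof.
move=> mono /choice[c cP]; exists (\sum_i c i); split.
  by apply: sumr_ge0 => i _; case: (cP i).
move=> i; have [_] := cP i; apply: mono; rewrite (bigD1 i)//= lerDl.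
by apply: sumr_ge0 => k _; case: (cP k).
Qed.

Lemma regular_coef_bound (R : realType) (N : nat) (A : metricType R)
    (g : 'I_N -> R -> A -> R) : [set: A] !=set0 ->
  (forall i, regular_coef (g i)) ->
  exists M, forall i x a, 0 <= x -> `|g i x a| <= M.
Proof.
move=> [a0 _] greg.
have [|i|M [_ gM]] :=
    @finite_bound R N (fun i M => forall x a, 0 <= x -> `|g i x a| <= M).
- by move=> i C C' CC gC x a x0; exact: le_trans (gC x a x0) CC.
- have [_ [M gM] _] := greg i; exists M; split=> //.
  exact: le_trans (gM 0 a0 (lexx _)).
- by exists M => i x a x0; exact: gM.
Qed.

(** The interpolated value is an average of two grid values whose nodes are
    within one step of [x]. *)
Lemma interpolant_error (R : realType) (N : nat) (sigma : 'I_N -> R)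
    (u : network N R -> R) (h E C : R) (w : grid_fun R N) i x :
  0 < h -> (forall i, 0 < sigma i) -> 0 <= C ->
  (forall y z, 0 <= y -> 0 <= z ->
     `|edge u i z - edge u i y| <= C * `|z - y|) ->
  (forall j, `|grid_val w i j - edge u i (grid_pt sigma h i j)| <= E) ->
  0 <= x ->
  `|edge (interpolant sigma h w) i x - edge u i x| <= E + C * grid_step sigma h i.
Proof.
move=> h0 sigma0 C0 uC wE x0.
have s0 : 0 < grid_step sigma h i by rewrite mulr_gt0// sqrtr_gt0.
have pt0 k : 0 <= grid_pt sigma h i k by rewrite mulr_ge0// ltW.
pose j := Num.truncn (x / grid_step sigma h i).
have /andP[jx xj] : (j%:R <= x / grid_step sigma h i < j.+1%:R).
  by rewrite truncn_itv// divr_ge0// ltW.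
have {}jx : grid_pt sigma h i j <= x by rewrite -ler_pdivlMr.
have {}xj : x <= grid_pt sigma h i j.+1 by rewrite -ler_pdivrMr// ltW.
rewrite (interpolantE _ h0 (sigma0 i) (j := j)) ?jx//.
set al := _ / _; set be := _ / _.
have albe : al + be = 1.
  rewrite /al /be -mulrDl addrA subrK grid_ptS addrC addKr divff// gt_eqF//.
have al0 : 0 <= al by rewrite divr_ge0 ?subr_ge0// ltW.
have be0 : 0 <= be by rewrite divr_ge0 ?subr_ge0// ltW.
have node k : grid_pt sigma h i j <= grid_pt sigma h i k <= grid_pt sigma h i j.+1 ->
    `|grid_val w i k - edge u i x| <= E + C * grid_step sigma h i.
  move=> /andP[jk kj].
  have -> : grid_val w i k - edge u i x = (grid_val w i k - edge u i (grid_pt sigma h i k))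
     + (edge u i (grid_pt sigma h i k) - edge u i x) by ring.
  rewrite (le_trans (ler_normD _ _))// lerD//.
  apply: le_trans (uC _ _ x0 (pt0 k)) _; rewrite ler_wpM2l// ler_norml.
  by move: kj xj; rewrite grid_ptS => ? ?; apply/andP; split; lra.
have -> : al * grid_val w i j + be * grid_val w i j.+1 - edge u i x =
    al * (grid_val w i j - edge u i x) + be * (grid_val w i j.+1 - edge u i x)
    + (al + be - 1) * edge u i x by ring.
rewrite albe subrr mul0r addr0 (le_trans (ler_normD _ _))//.
rewrite [`|al * _|]normrM [`|be * _|]normrM (ger0_norm al0).
rewrite (ger0_norm be0) -[leRHS]mul1r -albe mulrDl.
have jj : grid_pt sigma h i j <= grid_pt sigma h i j.+1 by exact: le_trans xj.
by rewrite lerD// ler_wpM2l// node// ?lexx ?jj.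
Qed.

Theorem theorem4p6 (R : realType) (N : nat)
    (A : metricType R) (A_compact : compact [set: A])
    (A_nonempty : [set: A] !=set0)
    (lambda theta eta : R) (lambda_gt0 : 0 < lambda) (eta_ge0 : 0 <= eta)
    (gamma sigma : 'I_N -> R)
    (gamma_gt0 : forall i, 0 < gamma i) (gamma_sum : \sum_i gamma i = 1)
    (sigma_gt0 : forall i, 0 < sigma i)
    (b f : 'I_N -> R -> A -> R)
    (b_regular : forall i, regular_coef (b i))
    (f_regular : forall i, regular_coef (f i))
    (h0 : R) (h0_gt0 : 0 < h0)
    (h0_le : forall k, Num.sqrt h0 *
       sup [set r : R | exists i (x : R) a, 0 <= x /\ r = `|b i x a|] <= sigma k)
    (u : network N R -> R) (u_bounded : network_bounded u)
    (u_solution : viscosity_solution lambda theta eta gamma sigma b f u)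
    (u_h : R -> grid_fun R N)
    (u_h_solution : forall h : R, 0 < h < Num.min h0 lambda^-1 ->
       scheme_solution lambda theta eta gamma sigma b f h (u_h h)) :
  cvg_locally_uniformly (fun h => interpolant sigma h (u_h h)) u.
Proof.
have [a0 _] := A_nonempty.
have i0 : 'I_N.
  case: N gamma sigma gamma_sum {gamma_gt0 sigma_gt0 b f b_regular f_regular
    h0_le u u_bounded u_solution u_h u_h_solution} => [|n] gamma sigma gamma_sum.
    by exfalso; move/eqP: gamma_sum; rewrite big_ord0 eq_sym oner_eq0.
  exact: ord0.
have [B bB] := regular_coef_bound A_nonempty b_regular.
have [F fF] := regular_coef_bound A_nonempty f_regular.
have [U uU] := u_bounded.
have [d dP] := choice (viscosity_edge_smooth A_nonempty lambda_gt0 sigma_gt0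
  b_regular f_regular u_bounded u_solution).
have [C [C0 smooth]] := finite_bound
  (fun i => @smooth_edge_le _ _ _ lambda sigma b f u i (d i)) dP.
have vertex0 := viscosity_vertex_condition sigma_gt0 u_solution C0 smooth.
pose sg := \sum_i sigma i.
have sigma_le i : sigma i <= sg.
  by rewrite /sg (bigD1 i)//= lerDl sumr_ge0// => k _; exact: ltW.
have sg0 : 0 < sg by exact: lt_le_trans (sigma_le i0).
pose S := \sum_k gamma k * sigma k.
have S0 : 0 < S.
  rewrite /S (bigD1 i0)//= ltr_pwDl ?mulr_gt0// sumr_ge0// => k _.
  by rewrite mulr_ge0// ltW.
have B0 : 0 <= B by exact: le_trans (bB i0 0 a0 (lexx _)).
have F0 : 0 <= F by exact: le_trans (fF i0 0 a0 (lexx _)).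
have U0 : 0 <= U by exact: le_trans (uU vertex).
(* The constants in the residuals of [u] at the vertex and on the edges. *)
pose Cv := lambda * U + lambda * (sg * C) + C * sg ^+ 2.
pose Ce := 2 * (C * sg ^+ 3) + lambda * (B * C + (B * C + F + lambda * U)).
have Cv0 : 0 <= Cv.
  by rewrite /Cv !addr_ge0// !mulr_ge0// ?exprn_ge0// ltW.
have Ce0 : 0 <= Ce.
  by rewrite /Ce !addr_ge0// !mulr_ge0// ?exprn_ge0 ?addr_ge0 ?mulr_ge0// ltW.
pose C1 := 4 * Cv / S.
have C10 : 0 <= C1 by rewrite divr_ge0 ?mulr_ge0// ltW.
have C1_large : Cv <= C1 * S / 4.
  by rewrite /C1 le_eqVlt; apply/orP; left; apply/eqP; field; rewrite gt_eqF.
pose C2 := (Ce + C1 * (B + sg ^+ 2)) / lambda.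
have C20 : 0 <= C2.
  apply: divr_ge0; last exact: ltW.
  by apply: addr_ge0 => //; apply: mulr_ge0 => //; rewrite addr_ge0 ?sqr_ge0.
have C2_large : Ce + C1 * (B + sg ^+ 2) <= lambda * C2.
  by rewrite /C2 [lambda * _]mulrC divfK// gt_eqF.
pose D := C1 + C2 + C * sg.
have D0 : 0 <= D by rewrite /D !addr_ge0// mulr_ge0// ltW.
(* The last bound makes [h <= 1] and each grid step at most 1. *)
pose h1 := Num.min (Num.min h0 (2 * lambda)^-1) ((1 + sg)^-1 ^+ 2).
have h1_gt0 : 0 < h1.
  by rewrite !lt_min h0_gt0 invr_gt0 mulr_gt0//= exprn_gt0// invr_gt0 addr_gt0.
have error h p : 0 < h -> h < h1 ->
    `|interpolant sigma h (u_h h) p - u p| <= D * Num.sqrt h.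
  move=> h_gt0; rewrite !lt_min => /andP[/andP[hh0 hlam] hsg].
  have h_lambda : lambda * h <= 2^-1.
    have -> : 2^-1 = lambda * (2 * lambda)^-1 by field; rewrite gt_eqF.
    by rewrite ler_wpM2l ?(ltW lambda_gt0) ?(ltW hlam).
  have r_small : Num.sqrt h <= (1 + sg)^-1.
    have -> : (1 + sg)^-1 = Num.sqrt ((1 + sg)^-1 ^+ 2).
      by rewrite sqrtr_sqr ger0_norm// invr_ge0 addr_ge0// ltW.
    by rewrite ler_wsqrtr// ltW.
  have sg1 : 0 < 1 + sg by rewrite addr_gt0.
  have h_sigma : sg * Num.sqrt h <= 1.
    have : (1 + sg) * Num.sqrt h <= 1 by rewrite mulrC -ler_pdivlMr// mul1r.
    by rewrite mulrDl mul1r; have := sqrtr_ge0 h; lra.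
  have h_le1 : h <= 1.
    rewrite (le_trans (ltW hsg))// exprn_ile1 ?invr_ge0 ?(ltW sg1)//.
    by rewrite invf_le1//; lra.
  (* The bound on [h0], with [h <= h0]. *)
  have prob_ge0 i x a : 0 <= x ->
      0 <= prob_up sigma b h i x a /\ 0 <= prob_down sigma b h i x a.
    move=> x0.
    have : `|Num.sqrt h / sigma i * b i x a| <= 1.
      rewrite mulrAC normrM [`|_^-1|]gtr0_norm ?invr_gt0// ler_pdivrMr// mul1r.
      rewrite normrM ger0_norm ?sqrtr_ge0//; apply: le_trans (h0_le i).
      rewrite ler_pM ?sqrtr_ge0//; first by rewrite ler_wsqrtr// ltW.
      apply: sup_upper_bound; last by exists i, x, a.
      split; first by exists `|b i x a|, i, x, a.
      by exists B => _ [k [y [c [y0 ->]]]]; exact: bB.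
    by rewrite ler_norml /prob_up /prob_down => /andP[]; lra.
  have h_range : 0 < h < Num.min h0 lambda^-1.
    rewrite h_gt0 lt_min hh0 (lt_le_trans hlam)//.
    by rewrite lef_pV2 ?posrE ?mulr_gt0//; lra.
  have err i j := scheme_error A_nonempty lambda_gt0 eta_ge0 gamma_gt0 gamma_sum
    sigma_gt0 uU bB fF C0 smooth vertex0 sigma_le h_gt0 h_lambda h_le1 h_sigma
    prob_ge0 C10 C20 C1_large C2_large i j (u_h_solution h h_range).
  have edge_error i x : 0 <= x ->
      `|edge (interpolant sigma h (u_h h)) i x - edge u i x| <= D * Num.sqrt h.
    move=> x0; have [_ uC _ _] := smooth i.
    apply: le_trans (interpolant_error h_gt0 sigma_gt0 C0 uC (err i) x0) _.
    rewrite /D [leRHS]mulrDl lerD2l -mulrA ler_wpM2l// ler_wpM2r ?sqrtr_ge0//.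
  case: p => [[i [x x0]]|].
    have := edge_error i x (ltW x0).
    by rewrite /edge (point_gt0 i x0).
  by have := edge_error i0 0 (lexx _); rewrite /edge point0.
move=> p; exists setT; first exact: filterT.
move=> P /uniform_nbhs[E [entE EP]].
move: entE; rewrite -entourage_ballE => -[e /= e0 eE].
have D1 : 0 < D + 1 by rewrite ltr_wpDl.
have [c c0 ec] : exists2 c, 0 < c & (D + 1) * c = e.
  by exists (e / (D + 1)); [exact: divr_gt0|rewrite mulrC divfK// gt_eqF].
near=> h; apply: EP => q _; apply: eE => /=.
rewrite /ball /= distrC.
have h_gt0 : 0 < h by near: h; exact: nbhs_right_gt.
apply: le_lt_trans (error h q h_gt0 _) _.
  by near: h; exact: nbhs_right_lt.
apply: (@lt_le_trans _ _ ((D + 1) * Num.sqrt h)).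
  by rewrite ltr_pM2r ?sqrtr_gt0// ltrDl.
rewrite -ec; apply: ler_wpM2l; first exact: ltW.
rewrite -(ger0_norm (ltW c0)) -sqrtr_sqr ler_wsqrtr// ltW//.
by near: h; apply: nbhs_right_lt; rewrite exprn_gt0.
Unshelve. all: by end_near. Qed.
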